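(* The 20 point modules $M_{\mathbf u}$, $\mathbf u\in\mathfrak P$, are all the point modules for $\widetilde Q$; that is, every point module for $\widetilde Q$ is isomorphic to $M_{\mathbf u}$ for some $\mathbf u\in\mathfrak P$.
   Context: Let $k$ be an algebraically closed field of characteristic not $2$, and let $\alpha,\beta,\gamma\in k$ satisfy $\alpha+\beta+\gamma+\alpha\beta\gamma=0$ and $\{\alpha,\beta,\gamma\}\cap\{0,1,-1\}=\varnothing$; write $\alpha_1=\alpha,\alpha_2=\beta,\alpha_3=\gamma$. Fix $a,b,c,i\in k$ with $a^2=\alpha$, $b^2=\beta$, $c^2=\gamma$, $i^2=-1$. Let $\widetilde Q$ be the graded $k$-algebra generated by degree-one elements $y_0,y_1,y_2,y_3$ subject to the six relations $$y_0y_r-y_ry_0=\alpha_r(y_sy_t-y_ty_s),\qquad y_0y_r+y_ry_0=y_sy_t+y_ty_s,$$ $(r,s,t)$ running over the cyclic permutations of $(1,2,3)$. (This is the algebra of $\Gamma$-invariants $(Q\otimes M_2(k))^\Gamma$ for the 4-dimensional Sklyanin algebra $Q$ with parameters $\alpha,\beta,\gamma$ and $\Gamma=(\mathbb Z/2)^2$.) A point module for a connected graded algebra $A$ is a graded left $A$-module $M=\bigoplus_{n\ge0}M_n$ with $M=AM_0$ and $\dim_k M_n=1$ for all $n\ge 0$. Let $\mathfrak P=\mathfrak P_\infty\cup\mathfrak P_0\cup\mathfrak P_1\cup\mathfrak P_2\cup\mathfrak P_3\subset\mathbb P^3=\mathbb P(\widetilde Q_1^* )$ be the following set of 20 points (coordinates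 with respect to $(y_0,y_1,y_2,y_3)$): $\mathfrak P_\infty=\{(1,0,0,0),(0,1,0,0),(0,0,1,0),(0,0,0,1)\}$; $\mathfrak P_0=\{(1,1,1,1),(1,1,-1,-1),(1,-1,1,-1),(1,-1,-1,1)\}$; $\mathfrak P_1=\{(bc,-i,-ib,-c),(bc,-i,ib,c),(bc,i,-ib,c),(bc,i,ib,-c)\}$; $\mathfrak P_2=\{(ac,-a,-i,-ic),(ac,-a,i,ic),(ac,a,-i,ic),(ac,a,i,-ic)\}$; $\mathfrak P_3=\{(ab,-ia,-b,-i),(ab,-ia,b,i),(ab,ia,-b,i),(ab,ia,b,-i)\}$. Let $\gamma_r$ ($r=1,2,3$) act on $\mathbb P^3$ by fixing coordinates $0$ and $r$ and negating the other two. Define $\theta:\mathfrak P\to\mathfrak P$ by $\theta(\mathbf u)=\mathbf u$ for $\mathbf u\in\mathfrak P_\infty\cup\mathfrak P_0$ and $\theta(\mathbf u)=\gamma_r(\mathbf u)$ for $\mathbf u\in\mathfrak P_r$, $r=1,2,3$. For $\mathbf u\in\mathfrak P$ write $\theta^n(\mathbf u)=(\lambda_{n0},\lambda_{n1},\lambda_{n2},\lambda_{n3})$, $n\ge 0$. $M_{\mathbf u}$ denotes the point module for $\widetilde Q$ with homogeneous basis $e_0,e_1,\dots$, $\deg e_n=n$, and action $y_je_n=\lambda_{nj}e_{n+1}$. *)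

(* Defs.v *)
From HB Require Import structures.
From mathcomp Require Import all_boot all_order all_algebra.
From mathcomp Require Import generic_quotient ring_quotient.
From mathcomp.classical Require Import boolp.
From mathcomp.multinomials Require Import monalg.
From mathcomp Require Import finmap.
From mathcomp Require Import ring.

Set Implicit Arguments.
Unset Strict Implicit.
Unset Printing Implicit Defensive.

Import GRing.Theory.
Local Open Scope ring_scope.
Local Open Scope quotient_scope.

(* Graded left modules over an algebra A whose homogeneous components are
   given by Adeg.  The ground field acts through c%:A. *)

Record is_graded (k : fieldType) (A : algType k) (Adeg : nat -> A -> Prop)
    (M : lmodType A) (deg : nat -> M -> Prop) : Prop := IsGraded {
  graded0 : forall n, deg n 0;
  gradedP : forall n (c : k) x y, deg n x -> deg n y -> deg n (c%:A *: x + y);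
  graded_span : forall x, exists (N : nat) (z : nat -> M),
    (forall n, deg n (z n)) /\ x = \sum_(n < N) z n;
  graded_free : forall (N : nat) (z : nat -> M),
    (forall n, deg n (z n)) -> \sum_(n < N) z n = 0 ->
    forall n, (n < N)%N -> z n = 0;
  graded_act : forall m n a x, Adeg m a -> deg n x -> deg (m + n)%N (a *: x)
}.

Record grmod (k : fieldType) (A : algType k) (Adeg : nat -> A -> Prop) := GrMod {
  gm_sort :> lmodType A;
  gm_deg : nat -> gm_sort -> Prop;
  gm_graded : is_graded Adeg gm_deg
}.

Section PointModule.

Variables (k : fieldType) (A : algType k) (Adeg : nat -> A -> Prop).

Definition gen_deg0 (M : grmod Adeg) : Prop :=
  forall x : M, exists s : seq (A * M),
    (forall ax, List.In ax s -> gm_deg 0 ax.2) /\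
    x = \sum_(ax <- s) ax.1 *: ax.2.

Definition dim1 (M : grmod Adeg) (n : nat) : Prop :=
  exists2 e : M, gm_deg n e /\ e != 0 &
    forall x : M, gm_deg n x -> exists c : k, x = c%:A *: e.

Definition point_module (M : grmod Adeg) : Prop :=
  gen_deg0 M /\ forall n, dim1 M n.

Definition grmod_iso (M N : grmod Adeg) : Prop :=
  exists2 f : {linear M -> N}, bijective f &
    forall n x, gm_deg n x <-> gm_deg n (f x).

End PointModule.

Record tsideal (k : fieldType) (A : algType k) := TSIdeal {
  ts_pred :> {pred A};
  ts_zmod : zmod_closed ts_pred;
  tsMl : forall a x, x \in ts_pred -> a * x \in ts_pred;
  tsMr : forall a x, x \in ts_pred -> x * a \in ts_pred;
  ts1 : 1 \notin ts_pred
}.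

HB.instance Definition _ (k : fieldType) (A : algType k) (I : tsideal A) :=
  GRing.isZmodClosed.Build A (ts_pred I) (ts_zmod I).

Section AlgQuot.

Variables (k : fieldType) (A : algType k) (I : tsideal A).

Definition algquot : Type := {ideal_quot ts_pred I}.

HB.instance Definition _ := Choice.on algquot.
HB.instance Definition _ := GRing.Zmodule.on algquot.

Definition aq_pi (f : A) : algquot := \pi_{ideal_quot ts_pred I} f.
Definition aq_repr (q : algquot) : A := repr (q : {ideal_quot ts_pred I}).

Lemma aq_reprK : cancel aq_repr aq_pi.
Proof. exact: reprK. Qed.

Lemma aq_piP f g : aq_pi f = aq_pi g <-> f - g \in ts_pred I.
Proof. by rewrite Quotient.idealrBE; split=> [h|/eqP//]; apply/eqP. Qed.

Lemma aq_piD f g : aq_pi (f + g) = aq_pi f + aq_pi g.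
Proof. exact: (raddfD (\pi_{ideal_quot ts_pred I})). Qed.

Lemma aq_pi0 : aq_pi 0 = 0.
Proof. exact: (raddf0 (\pi_{ideal_quot ts_pred I})). Qed.

Definition aq_one : algquot := aq_pi 1.
Definition aq_mul (p q : algquot) : algquot := aq_pi (aq_repr p * aq_repr q).

Lemma aq_piM_def f g : aq_pi (f * g) = aq_mul (aq_pi f) (aq_pi g).
Proof.
apply/aq_piP; set f' := aq_repr _; set g' := aq_repr _.
have hf : f - f' \in ts_pred I by apply/aq_piP; rewrite aq_reprK.
have hg : g - g' \in ts_pred I by apply/aq_piP; rewrite aq_reprK.
have -> : f * g - f' * g' = (f - f') * g + f' * (g - g').
  by rewrite mulrBl mulrBr addrA subrK.
by rewrite (rpredD (tsMr _ hf)) ?tsMl.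
Qed.

Fact aq_mulA : associative aq_mul.
Proof.
by move=> x y z; rewrite -[x]aq_reprK -[y]aq_reprK -[z]aq_reprK -!aq_piM_def mulrA.
Qed.
Fact aq_mul1 : left_id aq_one aq_mul.
Proof. by move=> x; rewrite -[x]aq_reprK -aq_piM_def mul1r. Qed.
Fact aq_mulr1 : right_id aq_one aq_mul.
Proof. by move=> x; rewrite -[x]aq_reprK -aq_piM_def mulr1. Qed.
Fact aq_mulDl : left_distributive aq_mul +%R.
Proof.
move=> x y z; rewrite -[x]aq_reprK -[y]aq_reprK -[z]aq_reprK.
by rewrite -!(aq_piM_def, aq_piD) mulrDl.
Qed.
Fact aq_mulDr : right_distributive aq_mul +%R.
Proof.
move=> x y z; rewrite -[x]aq_reprK -[y]aq_reprK -[z]aq_reprK.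
by rewrite -!(aq_piM_def, aq_piD) mulrDr.
Qed.
Fact aq_one_neq0 : aq_one != 0.
Proof.
apply/eqP; rewrite -aq_pi0 => /aq_piP; rewrite subr0; exact/negP/ts1.
Qed.

HB.instance Definition _ := GRing.Zmodule_isNzRing.Build algquot
  aq_mulA aq_mul1 aq_mulr1 aq_mulDl aq_mulDr aq_one_neq0.

Definition aq_scale (c : k) (q : algquot) : algquot := aq_pi (c *: aq_repr q).

Lemma aq_piZ_def c f : aq_pi (c *: f) = aq_scale c (aq_pi f).
Proof.
apply/aq_piP; rewrite -scalerBr -mulr_algl tsMl //.
by apply/aq_piP; rewrite aq_reprK.
Qed.

Fact aq_scaleA c d q : aq_scale c (aq_scale d q) = aq_scale (c * d) q.
Proof. by rewrite -[q]aq_reprK -!aq_piZ_def scalerA. Qed.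
Fact aq_scale1 : left_id 1 aq_scale.
Proof. by move=> q; rewrite -[q]aq_reprK -aq_piZ_def scale1r. Qed.
Fact aq_scaleDr : right_distributive aq_scale +%R.
Proof.
move=> c p q; rewrite -[p]aq_reprK -[q]aq_reprK.
by rewrite -!(aq_piZ_def, aq_piD) scalerDr.
Qed.
Fact aq_scaleDl q : {morph aq_scale^~ q : c d / c + d}.
Proof.
by move=> c d; rewrite -[q]aq_reprK -!(aq_piZ_def, aq_piD) scalerDl.
Qed.

HB.instance Definition _ := GRing.Zmodule_isLmodule.Build k algquot
  aq_scaleA aq_scale1 aq_scaleDr aq_scaleDl.

Lemma aq_piM f g : aq_pi (f * g) = aq_pi f * aq_pi g.
Proof. exact: aq_piM_def. Qed.
Lemma aq_pi1 : aq_pi 1 = 1.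
Proof. by []. Qed.
Lemma aq_piZ c f : aq_pi (c *: f) = c *: aq_pi f.
Proof. exact: aq_piZ_def. Qed.

Fact aq_scaleAl (c : k) (p q : algquot) : c *: (p * q) = (c *: p) * q.
Proof.
rewrite -[p]aq_reprK -[q]aq_reprK -aq_piM -!aq_piZ -aq_piM.
by congr aq_pi; exact: scalerAl.
Qed.

HB.instance Definition _ := GRing.Lmodule_isLalgebra.Build k algquot aq_scaleAl.

Fact aq_scaleAr (c : k) (p q : algquot) : c *: (p * q) = p * (c *: q).
Proof.
rewrite -[p]aq_reprK -[q]aq_reprK -aq_piM -!aq_piZ -aq_piM.
by congr aq_pi; exact: scalerAr.
Qed.

HB.instance Definition _ := GRing.Lalgebra_isAlgebra.Build k algquot aq_scaleAr.

(* An A-module annihilated by I is an A/I-module. *)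

Variables (V : lmodType A) (V_ann : forall x (v : V), x \in ts_pred I -> x *: v = 0).

Definition descend of (forall x (v : V), x \in ts_pred I -> x *: v = 0) : Type := V.

Local Notation W := (descend V_ann).

HB.instance Definition _ := GRing.Zmodule.on W.

Definition descend_scale (q : algquot) (v : W) : W := aq_repr q *: (v : V).

Lemma descend_scaleE f (v : W) : descend_scale (aq_pi f) v = f *: (v : V).
Proof.
apply/eqP; rewrite -subr_eq0; apply/eqP; rewrite /descend_scale.
rewrite -[LHS](@scalerBl A V) V_ann //.
by apply/aq_piP; rewrite aq_reprK.
Qed.

Fact descend_scaleA p q v :
  descend_scale p (descend_scale q v) = descend_scale (p * q) v.
Proof.
rewrite -[p]aq_reprK -[q]aq_reprK -aq_piM !descend_scaleE.
exact: (@scalerA A V).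
Qed.
Fact descend_scale1 : left_id 1 descend_scale.
Proof. by move=> v; rewrite -aq_pi1 descend_scaleE; exact: (@scale1r A V). Qed.
Fact descend_scaleDr : right_distributive descend_scale +%R.
Proof. move=> p v w; exact: (@scalerDr A V). Qed.
Fact descend_scaleDl v : {morph descend_scale^~ v : p q / p + q}.
Proof.
move=> p q; rewrite -[p]aq_reprK -[q]aq_reprK -aq_piD !descend_scaleE.
exact: (@scalerDl A V).
Qed.

HB.instance Definition _ := GRing.Zmodule_isLmodule.Build algquot W
  descend_scaleA descend_scale1 descend_scaleDr descend_scaleDl.

Lemma descendE f (v : W) : aq_pi f *: v = f *: (v : V).
Proof. exact: descend_scaleE. Qed.

End AlgQuot.

Inductive ideal_gen (R : nzRingType) (S : R -> Prop) : R -> Prop :=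
| ideal_gen_in x : S x -> ideal_gen S x
| ideal_gen0 : ideal_gen S 0
| ideal_genB x y : ideal_gen S x -> ideal_gen S y -> ideal_gen S (x - y)
| ideal_genMl a x : ideal_gen S x -> ideal_gen S (a * x)
| ideal_genMr a x : ideal_gen S x -> ideal_gen S (x * a).

Fact malg_scalerAr (K : monomType) (R : comNzRingType) (c : R)
    (f g : {malg R[K]}) :
  c *: (f * g) = f * (c *: g).
Proof.
have comm : c%:MP * f = f * c%:MP.
  rewrite !malgM_def fgmulUg fgmulgU; apply: eq_bigr => w _.
  by rewrite mul1m mulm1 mulrC.
rewrite -(mul_malgC c g) -(mul_malgC c (f * g)).
by transitivity (c%:MP * f * g); [exact: mulrA | rewrite comm; exact/esym/mulrA].
Qed.

(* The library puts an algebra structure on {malg R[K]} only for commutative K,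
   hence an alias. *)
Definition free4 (k : fieldType) : Type := {malg k[{fmonom 'I_4}]}.

HB.instance Definition _ (k : fieldType) :=
  GRing.Lalgebra.copy (free4 k) {malg k[{fmonom 'I_4}]}.
HB.instance Definition _ (k : fieldType) :=
  GRing.Lalgebra_isAlgebra.Build k (free4 k) (@malg_scalerAr {fmonom 'I_4} k).

Section TildeQ.

Variable k : fieldType.

Definition free_y (j : 'I_4) : free4 k := << fmu j >>.

Variables al be ga : k.

Definition cyclic_data : seq (k * ('I_4 * 'I_4 * 'I_4)) :=
  [:: (al, (1, 2, 3)); (be, (2, 3, 1)); (ga, (3, 1, 2))].

Definition minus_relator (d : k * ('I_4 * 'I_4 * 'I_4)) : free4 k :=
  let: (a, (r, s, t)) := d in
  free_y 0 * free_y r - free_y r * free_y 0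
    - a *: (free_y s * free_y t - free_y t * free_y s).

Definition plus_relator (d : k * ('I_4 * 'I_4 * 'I_4)) : free4 k :=
  let: (_, (r, s, t)) := d in
  free_y 0 * free_y r + free_y r * free_y 0
    - (free_y s * free_y t + free_y t * free_y s).

Definition relators : seq (free4 k) :=
  map minus_relator cyclic_data ++ map plus_relator cyclic_data.

Definition tQ_rel : {pred free4 k} :=
  fun f => `[< ideal_gen (fun x => x \in relators) f >].

Lemma tQ_relP f :
  reflect (ideal_gen (fun x => x \in relators) f) (f \in tQ_rel).
Proof. exact: asboolP. Qed.

Fact tQ_rel_zmod : zmod_closed tQ_rel.
Proof.
split; first by apply/tQ_relP; exact: ideal_gen0.
by move=> x y /tQ_relP hx /tQ_relP hy; apply/tQ_relP; exact: ideal_genB.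
Qed.

Fact tQ_relMl a f : f \in tQ_rel -> a * f \in tQ_rel.
Proof. by move=> /tQ_relP h; apply/tQ_relP; exact: ideal_genMl. Qed.

Fact tQ_relMr a f : f \in tQ_rel -> f * a \in tQ_rel.
Proof. by move=> /tQ_relP h; apply/tQ_relP; exact: ideal_genMr. Qed.

Lemma relator_rmorph (A B : nzRingType) (phi : {rmorphism A -> B})
    (c x y z w : A) :
  phi x = 0 -> phi y = 0 -> phi z = 0 -> phi w = 0 ->
  phi (x * y - y * x - c * (z * w - w * z)) = 0 /\
  phi (x * y + y * x - (z * w + w * z)) = 0.
Proof.
move=> hx hy hz hw.
by rewrite !(rmorphB, rmorphD, rmorphM) hx hy hz hw !(mulr0, subr0, addr0).
Qed.

Lemma free_y_aug j : mcoeff mone (free_y j) = 0.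
Proof. by rewrite /free_y mcoeffU1 fm1_eq1. Qed.

Lemma relator_aug f : f \in relators -> mcoeff mone f = 0.
Proof.
rewrite mem_cat => /orP[] /mapP[[a [[r s] t]] _ ->] /=.
- rewrite -mul_malgC.
  exact: (relator_rmorph (phi := mcoeff mone) _ (free_y_aug _) (free_y_aug _)
    (free_y_aug _) (free_y_aug _)).1.
- exact: (relator_rmorph (phi := mcoeff mone) 0 (free_y_aug _) (free_y_aug _)
    (free_y_aug _) (free_y_aug _)).2.
Qed.

Lemma tQ_rel_aug f : f \in tQ_rel -> mcoeff mone f = 0.
Proof.
move=> /tQ_relP; elim=> {f} [f| |f g _ hf _ hg|a f _ hf|a f _ hf].
- exact: relator_aug.
- exact: mcoeff0.
- by rewrite mcoeffB hf hg subr0.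
- exact: etrans (rmorphM (mcoeff mone) a f) (etrans (congr1 _ hf) (mulr0 _)).
- exact: etrans (rmorphM (mcoeff mone) f a)
    (etrans (congr1 ( *%R^~ _) hf) (mul0r _)).
Qed.

Fact tQ_rel1 : 1 \notin tQ_rel.
Proof. by apply/negP => /tQ_rel_aug/eqP; rewrite mcoeff1 eqxx oner_eq0. Qed.

Definition tQ_ideal : tsideal (free4 k) :=
  TSIdeal tQ_rel_zmod tQ_relMl tQ_relMr tQ_rel1.

Definition tQ : algType k := algquot tQ_ideal.

Definition tQ_y (j : 'I_4) : tQ := aq_pi tQ_ideal (free_y j).

Definition tQ_deg (n : nat) (q : tQ) : Prop :=
  exists2 f : free4 k, (forall w, w \in msupp f -> fdeg w = n)
                     & q = aq_pi tQ_ideal f.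

End TildeQ.

(* The free4-module structure on a vector space V on which y_j acts by h j. *)
Section WordModule.

Variables (k : fieldType) (V : lmodType k) (h : 'I_4 -> {linear V -> V}).

Definition wordmod of ('I_4 -> {linear V -> V}) : Type := V.

Local Notation W := (wordmod h).

HB.instance Definition _ := GRing.Zmodule.on W.

Definition word_act (w : seq 'I_4) (v : V) : V := foldr (fun j => h j) v w.

Definition free_act (f : free4 k) (v : W) : W :=
  \sum_(w <- msupp f) f@_w *: word_act w (v : V) :> V.

Lemma word_actP w a (u v : V) :
  word_act w (a *: u + v) = a *: word_act w u + word_act w v.
Proof. by elim: w => //= j w ->; rewrite linearP. Qed.

Lemma word_act0 w : word_act w 0 = 0.
Proof. by elim: w => //= j w ->; rewrite linear0. Qed.

Lemma word_actZ w a v : word_act w (a *: v) = a *: word_act w v.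
Proof. by rewrite -[a *: v]addr0 word_actP word_act0 !addr0. Qed.

Lemma word_actD w u v : word_act w (u + v) = word_act w u + word_act w v.
Proof. by rewrite -[u]scale1r word_actP !scale1r. Qed.

Lemma free_actEw (d : {fset {fmonom 'I_4}}) f v : (msupp f `<=` d)%fset ->
  free_act f v = \sum_(w <- d) f@_w *: word_act w (v : V) :> V.
Proof.
move=> le; rewrite /free_act; apply: big_fset_incl => // w _ /mcoeff_outdom ->.
by rewrite scale0r.
Qed.

Lemma free_actU c w v : free_act << c *g w >> v = c *: word_act w (v : V) :> V.
Proof. by rewrite (free_actEw _ msuppU_le) big_seq_fset1 mcoeffUU. Qed.

Fact free_actDl v : {morph free_act^~ v : f g / f + g}.
Proof.
move=> f g; rewrite (free_actEw v (msuppD_le f g)).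
rewrite (free_actEw v (fsubsetUl (msupp f) (msupp g))).
rewrite (free_actEw v (fsubsetUr (msupp f) (msupp g))).
rewrite -[RHS](@big_split V); apply: eq_bigr => w _.
by rewrite mcoeffD; exact: (@scalerDl k V).
Qed.

Fact free_actDr : right_distributive free_act +%R.
Proof.
move=> f u v; rewrite /free_act -[RHS](@big_split V); apply: eq_bigr => w _ /=.
by rewrite -(@scalerDr k V) -word_actD.
Qed.

Lemma free_act_suml (I : Type) (r : seq I) (F : I -> free4 k) v :
  free_act (\sum_(i <- r) F i) v = \sum_(i <- r) free_act (F i) v.
Proof.
elim: r => [|i r IH]; last by rewrite !big_cons free_actDl IH.
by rewrite !big_nil /free_act msupp0 big_seq_fset0.
Qed.

Lemma free_act_sumr (I : Type) (r : seq I) (F : I -> W) f :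
  free_act f (\sum_(i <- r) F i) = \sum_(i <- r) free_act f (F i).
Proof.
elim: r => [|i r IH]; last by rewrite !big_cons free_actDr IH.
rewrite !big_nil /free_act (@big1 V) // => w _.
by rewrite [word_act _ _](word_act0 w); exact: (@scaler0 k V).
Qed.

Fact free_actA f g v : free_act f (free_act g v) = free_act (f * g) v.
Proof.
rewrite malgME free_act_suml [LHS]/free_act; apply: eq_bigr => w1 _.
rewrite free_act_suml [free_act g v]/free_act.
have -> : word_act w1 (\sum_(w <- msupp g) g@_w *: word_act w (v : V)) =
   \sum_(w <- msupp g) g@_w *: word_act w1 (word_act w (v : V)).
  elim: (enum_fset (msupp g)) => [|w r IH]; first by rewrite !big_nil word_act0.
  by rewrite !big_cons word_actP IH.
rewrite (@scaler_sumr k V); apply: eq_bigr => w2 _.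
by rewrite free_actU (@scalerA k V) fmM /word_act foldr_cat.
Qed.

Fact free_act1 : left_id 1 free_act.
Proof. by move=> v; rewrite free_actU (@scale1r k V) fm1. Qed.

HB.instance Definition _ := GRing.Zmodule_isLmodule.Build (free4 k) W
  free_actA free_act1 free_actDr free_actDl.

Lemma free_yE j (v : W) : free_y k j *: v = h j (v : V) :> V.
Proof. by rewrite [LHS]free_actU (@scale1r k V) fmuE. Qed.

Lemma free_scaleE (c : k) (v : W) : (c%:A : free4 k) *: v = c *: (v : V) :> V.
Proof.
rewrite -mul_malgC mulr1.
by rewrite [LHS]free_actU fm1.
Qed.

End WordModule.

Lemma minus_actE (k : fieldType) (A : algType k) (V : lmodType A) (c : k)
    (x y z w : A) (v : V) :
  (x * y - y * x - c *: (z * w - w * z)) *: v =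
  (x *: (y *: v) - y *: (x *: v)) - c%:A *: (z *: (w *: v) - w *: (z *: v)).
Proof. by rewrite !scalerBl -[c *: _]mulr_algl -!scalerA scalerBl -!scalerA. Qed.

Lemma plus_actE (k : fieldType) (A : algType k) (V : lmodType A)
    (x y z w : A) (v : V) :
  (x * y + y * x - (z * w + w * z)) *: v =
  (x *: (y *: v) + y *: (x *: v)) - (z *: (w *: v) + w *: (z *: v)).
Proof. by rewrite !scalerBl !scalerDl -!scalerA. Qed.

Section SequenceModule.

Variables (k : fieldType) (lam : nat -> 'rV[k]_4).

(* 'X^n plays the role of e_n, so y_j sends 'X^n to lam n 0 j *: 'X^(n.+1). *)
Definition shift_act (j : 'I_4) (p : {poly k}) : {poly k} :=
  'X * \poly_(n < size p) (lam n 0 j * p`_n).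

Lemma shift_actS j p n : (shift_act j p)`_n.+1 = lam n 0 j * p`_n.
Proof.
rewrite coefXM coef_poly /=; case: ltnP => // le.
by rewrite nth_default // mulr0.
Qed.

Lemma shift_act_coef0 j p : (shift_act j p)`_0 = 0.
Proof. by rewrite coefXM. Qed.

Fact shift_act_linear j : linear (shift_act j).
Proof.
move=> c p q; apply/polyP => -[|n]; rewrite coefD coefZ.
  by rewrite !shift_act_coef0 mulr0 addr0.
by rewrite !shift_actS coefD coefZ mulrDr mulrCA.
Qed.

HB.instance Definition _ j :=
  GRing.isLinear.Build k {poly k} {poly k} *:%R (shift_act j) (shift_act_linear j).

Lemma shift_actX j n : shift_act j 'X^n = lam n 0 j *: 'X^(n.+1).
Proof.
apply/polyP => -[|m]; rewrite coefZ coefXn ?shift_act_coef0 ?mulr0 //.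
rewrite shift_actS coefXn eqSS.
by case: eqP => [->|] //; rewrite !mulr0.
Qed.

Definition freemod : lmodType (free4 k) :=
  wordmod (fun j => shift_act j : {linear {poly k} -> {poly k}}).

Variables al be ga : k.

(* The defining relations, evaluated on M_n with u the action of the y_j from
   degree n to n+1 and v the action from degree n+1 to n+2. *)
Definition rel_pair (u v : 'rV[k]_4) : Prop :=
  forall a r s t, (a, (r, s, t)) \in cyclic_data al be ga ->
    v 0 0 * u 0 r - v 0 r * u 0 0 = a * (v 0 s * u 0 t - v 0 t * u 0 s) /\
    v 0 0 * u 0 r + v 0 r * u 0 0 = v 0 s * u 0 t + v 0 t * u 0 s.

Hypothesis lam_rel : forall n, rel_pair (lam n) (lam n.+1).

Lemma freemod_y j (p : freemod) : free_y k j *: p = shift_act j p :> {poly k}.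
Proof. exact: free_yE. Qed.

Lemma freemod_Z (c : k) (p : freemod) :
  (c%:A : free4 k) *: p = c *: (p : {poly k}) :> {poly k}.
Proof. exact: free_scaleE. Qed.

Lemma shift_act2S i j p n :
  (shift_act i (shift_act j p))`_n.+2 = lam n.+1 0 i * lam n 0 j * p`_n.
Proof. by rewrite !shift_actS mulrA. Qed.

Lemma shift_rel a r s t (p : {poly k}) :
    (a, (r, s, t)) \in cyclic_data al be ga ->
  (shift_act 0 (shift_act r p) - shift_act r (shift_act 0 p))
    - a *: (shift_act s (shift_act t p) - shift_act t (shift_act s p)) = 0 /\
  (shift_act 0 (shift_act r p) + shift_act r (shift_act 0 p))
    - (shift_act s (shift_act t p) + shift_act t (shift_act s p)) = 0.
Proof.
move=> hd; split; apply/polyP => -[|[|n]].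
- by rewrite !(coefB, coefZ) !shift_act_coef0 !(subr0, mulr0) coef0.
- rewrite !(coefB, coefZ) !shift_actS !shift_act_coef0.
  by rewrite !(subr0, mulr0) coef0.
- rewrite !(coefB, coefZ) !shift_act2S coef0 -!mulrBl.
  have [-> _] := lam_rel n hd.
  by rewrite mulrA subrr.
- by rewrite coefB !coefD !shift_act_coef0 !addr0 subr0 coef0.
- rewrite coefB !coefD !shift_actS !shift_act_coef0.
  by rewrite !mulr0 !addr0 subr0 coef0.
- rewrite coefB !coefD !shift_act2S coef0 -!mulrDl.
  have [_ ->] := lam_rel n hd.
  by rewrite subrr.
Qed.

Lemma freemod_relators f (p : freemod) : f \in relators al be ga -> f *: p = 0.
Proof.
rewrite mem_cat => /orP[] /mapP[[a [[r s] t]] hd ->].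
- apply: etrans (minus_actE _ _ _ _ _ _) _.
  by rewrite freemod_Z !freemod_y; exact: (shift_rel _ hd).1.
- apply: etrans (plus_actE _ _ _ _ _) _.
  by rewrite !freemod_y; exact: (shift_rel _ hd).2.
Qed.

Lemma freemod_ann f (p : freemod) : f \in ts_pred (tQ_ideal al be ga) -> f *: p = 0.
Proof.
move=> /tQ_relP hf; elim: hf p => {f} [f hf| |f g _ hf _ hg|a f _ hf|a f _ hf] p.
- exact: freemod_relators.
- exact: scale0r.
- by rewrite scalerBl hf hg subrr.
- by rewrite -scalerA hf scaler0.
- by rewrite -scalerA hf.
Qed.

Definition seqmod : lmodType (tQ al be ga) := descend freemod_ann.

Definition seqmod_poly (x : seqmod) : {poly k} := x.
Definition poly_seqmod (p : {poly k}) : seqmod := p.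

Definition seqmod_deg (n : nat) (x : seqmod) : Prop :=
  seqmod_poly x = (seqmod_poly x)`_n *: 'X^n.

Lemma seqmod_y j (p : {poly k}) :
  tQ_y al be ga j *: poly_seqmod p = poly_seqmod (shift_act j p).
Proof. by rewrite [LHS]descendE; exact: free_yE. Qed.

Lemma seqmodZ (c : k) (x : seqmod) :
  seqmod_poly ((c%:A : tQ al be ga) *: x) = c *: seqmod_poly x.
Proof.
have -> : c%:A = aq_pi (tQ_ideal al be ga) (c%:A) by rewrite aq_piZ.
by rewrite /seqmod_poly descendE; exact: free_scaleE.
Qed.

Lemma seqmod_polyI : injective seqmod_poly.
Proof. by []. Qed.

Lemma seqmod_polyD x y :
  seqmod_poly (x + y) = seqmod_poly x + seqmod_poly y.
Proof. by []. Qed.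

Lemma seqmod_poly_sum (N : nat) (z : 'I_N -> seqmod) :
  seqmod_poly (\sum_(n < N) z n) = \sum_(n < N) seqmod_poly (z n).
Proof. by []. Qed.

Lemma seqmod_degZX n (c : k) : seqmod_deg n (poly_seqmod (c *: 'X^n)).
Proof. by rewrite /seqmod_deg /seqmod_poly coefZ coefXn eqxx mulr1. Qed.

Lemma word_shift_deg w n (p : {poly k}) : p = p`_n *: 'X^n ->
  exists c, word_act shift_act w p = c *: 'X^(size w + n).
Proof.
move=> hp; elim: w => [|j w [c IH]] /=; first by exists p`_n.
by exists (c * lam (size w + n) 0 j); rewrite IH linearZ /= shift_actX scalerA.
Qed.

Lemma seqmod_graded : is_graded (@tQ_deg k al be ga) seqmod_deg.
Proof.
split.
- by move=> n; rewrite /seqmod_deg /seqmod_poly coef0 scale0r.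
- move=> n c x y; rewrite /seqmod_deg seqmod_polyD seqmodZ => hx hy.
  by rewrite coefD coefZ scalerDl -scalerA -hx -hy.
- move=> x; exists (size (seqmod_poly x)).
  exists (fun n => poly_seqmod ((seqmod_poly x)`_n *: 'X^n)); split.
    by move=> n; exact: seqmod_degZX.
  have /esym := coefK (seqmod_poly x); rewrite poly_def; exact.
- move=> N z hz hs n ltnN.
  have := congr1 (fun x => (seqmod_poly x)`_n) hs.
  rewrite seqmod_poly_sum coef_sum (bigD1 (Ordinal ltnN)) //= big1 ?addr0.
    move=> z0; have := hz n; rewrite /seqmod_deg [(seqmod_poly _)`_n]z0.
    by rewrite coef0 scale0r.
  move=> m ne; rewrite (hz m) coefZ coefXn.
  by rewrite eq_sym [_ == _](negbTE ne) mulr0.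
- move=> m n q x [f hf ->] hx; rewrite /seqmod_deg.
  suff [c] : exists c, seqmod_poly (aq_pi (tQ_ideal al be ga) f *: x)
       = c *: 'X^(m + n).
    by move=> ->; rewrite coefZ coefXn eqxx mulr1.
  rewrite /seqmod_poly descendE.
  change (exists c, \sum_(w <- msupp f)
     f@_w *: word_act shift_act w (seqmod_poly x) = c *: 'X^(m + n)).
  rewrite big_seq; elim/big_ind: _ => [|p q' [c ->] [d ->]|w hw].
  + by exists 0; rewrite scale0r.
  + by exists (c + d); rewrite scalerDl.
  + have [c ->] := word_shift_deg w hx.
    by exists (f@_w * c); rewrite scalerA -(hf _ hw).
Qed.

Definition seq_grmod : grmod (@tQ_deg k al be ga) := GrMod seqmod_graded.

Lemma seq_point_module : (forall n, lam n != 0) -> point_module seq_grmod.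
Proof.
move=> lam0; split=> [x|n]; last first.
  exists (poly_seqmod 'X^n).
    split; first by have := seqmod_degZX n 1; rewrite scale1r.
    by apply/eqP => /(congr1 (fun p : {poly k} => p`_n))/eqP;
      rewrite coefXn eqxx coef0 oner_eq0.
  move=> x hx; exists (seqmod_poly x)`_n.
  by apply: seqmod_polyI; rewrite seqmodZ; exact: hx.
have gen n : exists q : tQ al be ga, q *: poly_seqmod 1 = poly_seqmod 'X^n.
  elim: n => [|n [q hq]]; first by exists 1; rewrite scale1r.
  have [j hj] : exists j, lam n 0 j != 0.
    apply/existsP; apply: contra_neqT (lam0 n) => /existsPn h.
    by apply/rowP => j; rewrite mxE; apply/eqP; have := h j; rewrite negbK.
  exists ((lam n 0 j)^-1%:A * (tQ_y al be ga j * q)).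
  rewrite -!scalerA hq seqmod_y shift_actX; apply: seqmod_polyI.
  by rewrite seqmodZ /seqmod_poly scalerA mulVf // scale1r.
have {}gen p : exists q : tQ al be ga, q *: poly_seqmod 1 = poly_seqmod p.
  elim/poly_ind: p => [|p c _]; first by exists 0; rewrite scale0r.
  move: {p c}(p * 'X + c%:P) => p; rewrite -[p]coefK poly_def.
  elim/big_ind: _ => [|p1 p2 [q1 h1] [q2 h2]|m _].
  - by exists 0; rewrite scale0r.
  - by exists (q1 + q2); rewrite scalerDl h1 h2.
  - have [q hq] := gen m; exists ((p`_m)%:A * q).
    by rewrite -scalerA hq; apply: seqmod_polyI; rewrite seqmodZ.
have [q hq] := gen (seqmod_poly x).
exists [:: (q, poly_seqmod 1)]; split; last by rewrite big_seq1.
by move=> ax [<-|//]; have := seqmod_degZX 0 1; rewrite scale1r.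
Qed.

End SequenceModule.

Section Points.

Variable k : fieldType.

Definition vec4 (x0 x1 x2 x3 : k) : 'rV[k]_4 := \row_j [:: x0; x1; x2; x3]`_j.

Variables a b c i : k.

Definition PPinf : seq 'rV[k]_4 :=
  [:: vec4 1 0 0 0; vec4 0 1 0 0; vec4 0 0 1 0; vec4 0 0 0 1].
Definition PP0 : seq 'rV[k]_4 :=
  [:: vec4 1 1 1 1; vec4 1 1 (-1) (-1); vec4 1 (-1) 1 (-1); vec4 1 (-1) (-1) 1].
Definition PP1 : seq 'rV[k]_4 :=
  [:: vec4 (b * c) (- i) (- (i * b)) (- c); vec4 (b * c) (- i) (i * b) c;
      vec4 (b * c) i (- (i * b)) c; vec4 (b * c) i (i * b) (- c)].
Definition PP2 : seq 'rV[k]_4 :=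
  [:: vec4 (a * c) (- a) (- i) (- (i * c)); vec4 (a * c) (- a) i (i * c);
      vec4 (a * c) a (- i) (i * c); vec4 (a * c) a i (- (i * c))].
Definition PP3 : seq 'rV[k]_4 :=
  [:: vec4 (a * b) (- (i * a)) (- b) (- i); vec4 (a * b) (- (i * a)) b i;
      vec4 (a * b) (i * a) (- b) i; vec4 (a * b) (i * a) b (- i)].

Definition PP : seq 'rV[k]_4 := PPinf ++ PP0 ++ PP1 ++ PP2 ++ PP3.

Definition gam (r : 'I_4) (u : 'rV[k]_4) : 'rV[k]_4 :=
  \row_j (if (j == 0) || (j == r) then u 0 j else - u 0 j).

(* On the chosen representatives of the points, theta permutes the
   representatives themselves, so no rescaling is involved. *)
Definition theta (u : 'rV[k]_4) : 'rV[k]_4 :=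
  if u \in PP1 then gam 1 u
  else if u \in PP2 then gam 2 u
  else if u \in PP3 then gam 3 u
  else u.

(* The hypotheses on the parameters al = alpha, be = beta,
   ga = gamma and on the chosen square roots a, b, c, i. *)
Record standing (al be ga : k) : Prop := Standing {
  char_neq2 : 2%N \notin [pchar k];
  sum_eq0 : al + be + ga + al * be * ga = 0;
  al_notin : al \notin [:: 0; 1; -1];
  be_notin : be \notin [:: 0; 1; -1];
  ga_notin : ga \notin [:: 0; 1; -1];
  a_sqr : a ^+ 2 = al;
  b_sqr : b ^+ 2 = be;
  c_sqr : c ^+ 2 = ga;
  i_sqr : i ^+ 2 = -1
}.

Variables al be ga : k.
Hypothesis H : standing al be ga.

Lemma vec4_0 x0 x1 x2 x3 : vec4 x0 x1 x2 x3 0 0 = x0.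
Proof. by rewrite mxE. Qed.
Lemma vec4_1 x0 x1 x2 x3 : vec4 x0 x1 x2 x3 0 1 = x1.
Proof. by rewrite mxE. Qed.
Lemma vec4_2 x0 x1 x2 x3 : vec4 x0 x1 x2 x3 0 2 = x2.
Proof. by rewrite mxE. Qed.
Lemma vec4_3 x0 x1 x2 x3 : vec4 x0 x1 x2 x3 0 3 = x3.
Proof. by rewrite mxE. Qed.
Definition vec4E := (vec4_0, vec4_1, vec4_2, vec4_3).

Lemma gam1_vec4 x0 x1 x2 x3 : gam 1 (vec4 x0 x1 x2 x3) = vec4 x0 x1 (- x2) (- x3).
Proof. by apply/rowP => -[[|[|[|[|//]]]] h]; rewrite !mxE. Qed.
Lemma gam2_vec4 x0 x1 x2 x3 : gam 2 (vec4 x0 x1 x2 x3) = vec4 x0 (- x1) x2 (- x3).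
Proof. by apply/rowP => -[[|[|[|[|//]]]] h]; rewrite !mxE. Qed.
Lemma gam3_vec4 x0 x1 x2 x3 : gam 3 (vec4 x0 x1 x2 x3) = vec4 x0 (- x1) (- x2) x3.
Proof. by apply/rowP => -[[|[|[|[|//]]]] h]; rewrite !mxE. Qed.

Lemma PP1_sqr u : u \in PP1 ->
  [/\ u 0 1 ^+ 2 = -1, u 0 2 ^+ 2 = - be & u 0 3 ^+ 2 = ga].
Proof.
by rewrite !inE => /or4P[] /eqP ->;
  rewrite !vec4E ?sqrrN ?exprMn (i_sqr H) ?(b_sqr H) ?(c_sqr H) ?mulN1r.
Qed.

Lemma PP2_sqr u : u \in PP2 ->
  [/\ u 0 1 ^+ 2 = al, u 0 2 ^+ 2 = -1 & u 0 3 ^+ 2 = - ga].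
Proof.
by rewrite !inE => /or4P[] /eqP ->;
  rewrite !vec4E ?sqrrN ?exprMn (i_sqr H) ?(a_sqr H) ?(c_sqr H) ?mulN1r.
Qed.

Lemma PP3_sqr u : u \in PP3 ->
  [/\ u 0 1 ^+ 2 = - al, u 0 2 ^+ 2 = be & u 0 3 ^+ 2 = -1].
Proof.
by rewrite !inE => /or4P[] /eqP ->;
  rewrite !vec4E ?sqrrN ?exprMn (i_sqr H) ?(a_sqr H) ?(b_sqr H) ?mulN1r.
Qed.

Lemma oneN1 : 1 != -1 :> k.
Proof.
apply/eqP => e; have := char_neq2 H; rewrite inE /= mulr2n {1}e.
by rewrite addNr eqxx.
Qed.

Lemma PP_fix u : u \in PPinf ++ PP0 -> theta u = u.
Proof.
move=> hu.
have s j : u 0 j ^+ 2 != -1.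
  have e : u 0 j \in [:: 0; 1; -1].
    move: hu; rewrite mem_cat !inE => /orP[] /or4P[] /eqP ->; rewrite mxE;
    by case: j => [[|[|[|[|//]]]] h] /=; rewrite eqxx ?orbT.
  have z : (0 : k) != -1 by rewrite eq_sym oppr_eq0 oner_eq0.
  by move: e; rewrite !inE => /or3P[] /eqP ->;
    rewrite ?sqrrN ?expr0n ?expr1n ?z ?oneN1.
rewrite /theta; case: ifP => [/PP1_sqr[e _ _]|_]; first by have := s 1; rewrite e eqxx.
case: ifP => [/PP2_sqr[_ e _]|_]; first by have := s 2; rewrite e eqxx.
by case: ifP => [/PP3_sqr[_ _ e]|_]; first by have := s 3; rewrite e eqxx.
Qed.

Lemma theta_PP1 u : u \in PP1 -> theta u = gam 1 u.
Proof. by rewrite /theta => ->. Qed.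

Lemma theta_PP2 u : u \in PP2 -> theta u = gam 2 u.
Proof.
rewrite /theta => hu; rewrite hu; case: ifP => // /PP1_sqr[_ e _].
have [_ e' _] := PP2_sqr hu; move: e; rewrite e' => /oppr_inj e.
by have := be_notin H; rewrite -e !inE eqxx orbT.
Qed.

Lemma theta_PP3 u : u \in PP3 -> theta u = gam 3 u.
Proof.
rewrite /theta => hu; rewrite hu; have [_ e2 e3] := PP3_sqr hu.
case: ifP => [/PP1_sqr[_ _ e]|_].
  by have := ga_notin H; rewrite -e e3 !inE eqxx !orbT.
case: ifP => [/PP2_sqr[_ e _]|//].
by have := be_notin H; rewrite -e2 e !inE eqxx !orbT.
Qed.

Lemma PPE u : u \in PP =
  [|| u \in PPinf ++ PP0, u \in PP1, u \in PP2 | u \in PP3].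
Proof. by rewrite /PP !mem_cat -!orbA. Qed.

Lemma theta_in u : u \in PP -> theta u \in PP.
Proof.
rewrite PPE => /or4P[] hu.
- by rewrite PP_fix // PPE hu.
- rewrite theta_PP1 // PPE; apply/or4P; constructor 2.
  by move: hu; rewrite !inE => /or4P[] /eqP ->; rewrite gam1_vec4 ?opprK eqxx ?orbT.
- rewrite theta_PP2 // PPE; apply/or4P; constructor 3.
  by move: hu; rewrite !inE => /or4P[] /eqP ->; rewrite gam2_vec4 ?opprK eqxx ?orbT.
- rewrite theta_PP3 // PPE; apply/or4P; constructor 4.
  by move: hu; rewrite !inE => /or4P[] /eqP ->; rewrite gam3_vec4 ?opprK eqxx ?orbT.
Qed.

Lemma rel_pair_theta u : u \in PP -> rel_pair al be ga u (theta u).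
Proof.
have hi := i_sqr H; have ha := a_sqr H; have hb := b_sqr H; have hc := c_sqr H.
rewrite PPE => /or4P[] hu d r s t.
- rewrite PP_fix // !inE; move: hu; rewrite mem_cat !inE.
  by move=> /orP[] /or4P[] /eqP -> /or3P[] /eqP[-> -> -> ->];
    rewrite !vec4E; split; ring.
- rewrite theta_PP1 // !inE; move: hu; rewrite !inE.
  move=> /or4P[] /eqP -> /or3P[] /eqP[-> -> -> ->];
    rewrite gam1_vec4 !vec4E -?ha -?hb -?hc; split; ring: hi.
- rewrite theta_PP2 // !inE; move: hu; rewrite !inE.
  move=> /or4P[] /eqP -> /or3P[] /eqP[-> -> -> ->];
    rewrite gam2_vec4 !vec4E -?ha -?hb -?hc; split; ring: hi.
- rewrite theta_PP3 // !inE; move: hu; rewrite !inE.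
  move=> /or4P[] /eqP -> /or3P[] /eqP[-> -> -> ->];
    rewrite gam3_vec4 !vec4E -?ha -?hb -?hc; split; ring: hi.
Qed.

Lemma iter_theta_in u n : u \in PP -> iter n theta u \in PP.
Proof. by move=> hu; elim: n => //= n; exact: theta_in. Qed.

Lemma PP_neq0 u : u \in PP -> u != 0.
Proof.
have i0 : i != 0.
  by apply/eqP => e; have /eqP := i_sqr H; rewrite e expr0n eq_sym oppr_eq0 oner_eq0.
move=> hu; apply/eqP => u0; move: hu; rewrite PPE u0 => /or4P[].
- rewrite mem_cat !inE => /orP[] /or4P[] /eqP/rowP e.
  all: try by have /eqP := e 0; rewrite vec4E mxE eq_sym oner_eq0.
  + by have /eqP := e 1; rewrite vec4E mxE eq_sym oner_eq0.
  + by have /eqP := e 2; rewrite vec4E mxE eq_sym oner_eq0.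
  + by have /eqP := e 3; rewrite vec4E mxE eq_sym oner_eq0.
- by case/PP1_sqr=> /eqP; rewrite mxE expr0n eq_sym oppr_eq0 oner_eq0.
- by case/PP2_sqr=> _ /eqP; rewrite mxE expr0n eq_sym oppr_eq0 oner_eq0.
- by case/PP3_sqr=> _ _ /eqP; rewrite mxE expr0n eq_sym oppr_eq0 oner_eq0.
Qed.

(* The module M_u of the point u: e_n is 'X^n, with theta^n(u) giving the
   action of the y_j from degree n to n+1, see ptmod_action. *)
Definition ptmod (u : 'rV[k]_4) (hu : u \in PP) : grmod (@tQ_deg k al be ga) :=
  seq_grmod (lam := fun n => iter n theta u)
    (fun n => rel_pair_theta (iter_theta_in n hu)).

Lemma ptmod_point_module u (hu : u \in PP) : point_module (ptmod hu).
Proof. by apply: seq_point_module => n; apply: PP_neq0; exact: iter_theta_in. Qed.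

Lemma ptmod_action u (hu : u \in PP) (j : 'I_4) (n : nat) :
  tQ_y al be ga j *: ('X^n : ptmod hu)
  = (iter n theta u 0 j)%:A *: ('X^(n.+1) : ptmod hu).
Proof.
rewrite [LHS]seqmod_y shift_actX; apply: (@seqmod_polyI k).
by rewrite seqmodZ.
Qed.

End Points.

(* Main.v *)
Require Import Defs.
From HB Require Import structures.
From mathcomp Require Import all_boot all_order all_algebra.
From mathcomp.multinomials Require Import monalg.
From mathcomp Require Import finmap ring.

(** Let [y_j] act from degree n to n+1 by the vector u and from n+1 to n+2 by v.
    The relations express the 4 x 4 matrix (v_i u_j) off the diagonal through
    S_r = v_s u_t + v_t u_s and A_r = v_s u_t - v_t u_s, and the vanishing of its
    2 x 2 minors yields (1 + al_r) A_r S_r = - (1 - al_t) A_t S_t for t = r - 1.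
    As sum_r al_r + prod_r al_r = 0 means prod (1 + al_r) = prod (1 - al_r), going
    once around the cycle gives A_r S_r = 0 for all r.  The remaining minors then
    leave only v proportional to u or to gam_r u, and u_0 u_r = kappa_r u_s u_t
    with explicit kappa_r; solving this gives the 20 points.  Off the coordinate
    planes kappa_1 separates the four cases, and on the coordinate points gam_r
    acts trivially, so v is determined by u up to a scalar and the sequence of
    actions is that of M_u up to rescaling the basis. *)

Set Implicit Arguments.
Unset Strict Implicit.
Unset Printing Implicit Defensive.

Import GRing.Theory.
Local Open Scope ring_scope.

(** * Vectors with four coordinates: proportionality, quadratic laws and their solutions *)

Section Coordinates.

Variable k : fieldType.
Implicit Types u v p : 'rV[k]_4.

Lemma ord4P (j : 'I_4) : [\/ j = 0, j = 1, j = 2 | j = 3].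
Proof.
case: j => [[|[|[|[|//]]]] h];
  [constructor 1|constructor 2|constructor 3|constructor 4]; exact: val_inj.
Qed.

Lemma rowP4 u v : u 0 0 = v 0 0 -> u 0 1 = v 0 1 -> u 0 2 = v 0 2 ->
  u 0 3 = v 0 3 -> u = v.
Proof. by move=> e0 e1 e2 e3; apply/rowP => j; case: (ord4P j) => ->. Qed.

Lemma proportional u v : u != 0 -> v != 0 ->
  (forall j l, v 0 j * u 0 l = v 0 l * u 0 j) ->
  exists2 c, c != 0 & v = c *: u.
Proof.
move=> /rV0Pn[j uj0] vn0 h.
have e : v = (v 0 j / u 0 j) *: u.
  by apply/rowP => l; rewrite mxE mulrAC h mulfK.
by exists (v 0 j / u 0 j) => //; apply: contraNneq vn0 => c0; rewrite e c0 scale0r.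
Qed.

Lemma proportional4 u v : u != 0 -> v != 0 ->
  v 0 0 * u 0 1 = v 0 1 * u 0 0 -> v 0 0 * u 0 2 = v 0 2 * u 0 0 ->
  v 0 0 * u 0 3 = v 0 3 * u 0 0 -> v 0 1 * u 0 2 = v 0 2 * u 0 1 ->
  v 0 1 * u 0 3 = v 0 3 * u 0 1 -> v 0 2 * u 0 3 = v 0 3 * u 0 2 ->
  exists2 c, c != 0 & v = c *: u.
Proof.
move=> un0 vn0 *; apply: proportional => // j l.
by case: (ord4P j) => ->; case: (ord4P l) => ->.
Qed.

(** [kap] packs (kappa_1, kappa_2, kappa_3). Such a law is what the relations impose on [u] once [v]
    is known to be proportional to a fixed sign change of [u]. *)
Definition tlaw (kap : k * k * k) u :=
  [/\ u 0 0 * u 0 1 = kap.1.1 * (u 0 2 * u 0 3),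
      u 0 0 * u 0 2 = kap.1.2 * (u 0 3 * u 0 1) &
      u 0 0 * u 0 3 = kap.2 * (u 0 1 * u 0 2)].

(** The orbit under the four-group formed by the identity and [gam r] for r = 1, 2, 3. *)
Definition sign_orbit x0 x1 x2 x3 : seq 'rV[k]_4 :=
  [:: vec4 x0 x1 x2 x3; vec4 x0 x1 (- x2) (- x3);
      vec4 x0 (- x1) x2 (- x3); vec4 x0 (- x1) (- x2) x3].

Lemma vec4_eta u : u = vec4 (u 0 0) (u 0 1) (u 0 2) (u 0 3).
Proof. by apply: rowP4; rewrite vec4E. Qed.

(** As the kappa_r are nonzero, one vanishing coordinate forces three to vanish. *)
Lemma tlaw_cases kap u : u != 0 ->
  kap.1.1 != 0 -> kap.1.2 != 0 -> kap.2 != 0 -> tlaw kap u ->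
  (exists2 p, p \in PPinf k & exists2 c, c != 0 & u = c *: p) \/
  forall j, u 0 j != 0.
Proof.
case: kap => [[k1 k2] k3] /= un0 k1n0 k2n0 k3n0 [/= e1 e2 e3].
have sc x0 x1 x2 x3 : vec4 x0 x1 x2 x3 \in PPinf k ->
    (exists c, u = c *: vec4 x0 x1 x2 x3) ->
    exists2 p, p \in PPinf k & exists2 c, c != 0 & u = c *: p.
  move=> hp [c uE]; exists (vec4 x0 x1 x2 x3) => //; exists c => //.
  by apply: contraNneq un0 => c0; rewrite uE c0 scale0r.
have z (c x y : k) : c != 0 -> 0 = c * (x * y) -> x = 0 \/ y = 0.
  move=> cn0 /esym/eqP; rewrite !mulf_eq0 (negbTE cn0) /=.
  by case/orP=> /eqP; [left|right].
have [u0|u0] := eqVneq (u 0 0) 0.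
  left; move: e1 e2 e3; rewrite u0 !mul0r.
  move=> /z-/(_ k1n0) d1 /z-/(_ k2n0) d2 /z-/(_ k3n0) d3.
  have [u1|u1] := eqVneq (u 0 1) 0; last first.
    apply: (sc 0 1 0 0); first by rewrite !inE eqxx ?orbT.
    exists (u 0 1); apply: rowP4; rewrite mxE vec4E ?mulr0 ?mulr1 //.
      by case: d3 u1 => [->|//]; rewrite eqxx.
    by case: d2 u1 => [//|->]; rewrite eqxx.
  case: d1 => d.
    apply: (sc 0 0 0 1); first by rewrite !inE eqxx ?orbT.
    by exists (u 0 3); apply: rowP4; rewrite mxE vec4E ?mulr0 ?mulr1.
  apply: (sc 0 0 1 0); first by rewrite !inE eqxx ?orbT.
  by exists (u 0 2); apply: rowP4; rewrite mxE vec4E ?mulr0 ?mulr1.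
have z0 x : u 0 0 * x = 0 -> x = 0.
  by move=> /eqP; rewrite mulf_eq0 (negbTE u0) => /eqP.
have [/and3P[u1 u2 u3]|] := boolP [&& u 0 1 != 0, u 0 2 != 0 & u 0 3 != 0].
  by right=> j; case: (ord4P j) => ->.
move=> hz; left; apply: (sc 1 0 0 0); first by rewrite !inE eqxx.
exists (u 0 0).
suff [u1 u2 u3] : [/\ u 0 1 = 0, u 0 2 = 0 & u 0 3 = 0].
  by apply: rowP4; rewrite mxE vec4E ?mulr0 ?mulr1.
(* A zero among the coordinates 1, 2, 3 kills the right-hand sides of the other two laws, where the
   nonzero [u 0 0] can be cancelled. *)
move: hz; rewrite !negb_and !negbK => /or3P[] /eqP d; split=> //; apply: z0;
  by rewrite ?e1 ?e2 ?e3 d ?(mulr0, mul0r).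
Qed.

(* The law determines the squares of the coordinate ratios, and the third ratio
   from the other two, so the solutions off the coordinate planes differ by
   an even number of signs. *)
Lemma tlaw_sign_orbit kap u x0 x1 x2 x3 :
  (forall j, u 0 j != 0) -> x0 != 0 ->
  x0 ^+ 2 = kap.1.1 * kap.2 * x2 ^+ 2 -> x0 ^+ 2 = kap.1.1 * kap.1.2 * x3 ^+ 2 ->
  x0 * x1 = kap.1.1 * (x2 * x3) ->
  tlaw kap u ->
  exists2 p, p \in sign_orbit x0 x1 x2 x3 & exists2 c, c != 0 & u = c *: p.
Proof.
case: kap => [[k1 k2] k3] /= un0 x0n0 h2 h3 h1 [/= e1 e2 e3].
pose c := u 0 0 / x0.
have cn0 : c != 0 by rewrite mulf_neq0 ?invr_eq0.
have u0E : u 0 0 = c * x0 by rewrite mulfVK.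
(* The product of the laws for r = 1 and r = 3, with [u 0 1 * u 0 3] cancelled; [sq3] uses r = 1 and
   r = 2. *)
have sq2 : u 0 0 ^+ 2 = k1 * k3 * u 0 2 ^+ 2.
  apply: (mulIf (mulf_neq0 (un0 1) (un0 3))).
  transitivity ((u 0 0 * u 0 1) * (u 0 0 * u 0 3)); first by ring.
  by rewrite e1 e3; ring.
have sq3 : u 0 0 ^+ 2 = k1 * k2 * u 0 3 ^+ 2.
  apply: (mulIf (mulf_neq0 (un0 1) (un0 2))).
  transitivity ((u 0 0 * u 0 1) * (u 0 0 * u 0 2)); first by ring.
  by rewrite e1 e2; ring.
have root (q x y : k) : x0 ^+ 2 = q * x ^+ 2 -> u 0 0 ^+ 2 = q * y ^+ 2 ->
    y = c * x \/ y = c * - x.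
  move=> hx hy; have qn0 : q != 0.
    apply: contraNneq x0n0 => q0; move: hx; rewrite q0 mul0r => /eqP.
    by rewrite sqrf_eq0.
  have /eqP : y ^+ 2 = (c * x) ^+ 2.
    by apply: (mulfI qn0); rewrite -hy u0E !exprMn hx; ring.
  by rewrite eqf_sqr mulrN => /orP[] /eqP; [left|right].
(* With [s2] and [s3] the signs of coordinates 2 and 3, the first law makes [s2 * s3] the sign of
   coordinate 1. *)
have u1E s2 s3 : u 0 2 = c * (s2 * x2) -> u 0 3 = c * (s3 * x3) ->
    u 0 1 = c * (s2 * s3 * x1).
  move=> E2 E3; apply: (mulfI (un0 0)); rewrite e1 E2 E3 u0E.
  transitivity (c * c * s2 * s3 * (k1 * (x2 * x3))); first by ring.
  by rewrite -h1; ring.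
have fin s1 s2 s3 p : vec4 x0 s1 s2 s3 = p -> u 0 1 = c * s1 -> u 0 2 = c * s2 ->
    u 0 3 = c * s3 -> exists2 c, c != 0 & u = c *: p.
  by move=> <- *; exists c => //; apply: rowP4; rewrite mxE vec4E.
case: (root _ _ _ h2 sq2) => E2; case: (root _ _ _ h3 sq3) => E3.
- exists (vec4 x0 x1 x2 x3); first by rewrite !inE eqxx.
  by apply: fin => //; rewrite (u1E 1 1) ?mul1r.
- exists (vec4 x0 (- x1) x2 (- x3)); first by rewrite !inE eqxx ?orbT.
  by apply: fin => //; rewrite (u1E 1 (- 1)) ?mul1r ?mulN1r.
- exists (vec4 x0 (- x1) (- x2) x3); first by rewrite !inE eqxx ?orbT.
  by apply: fin => //; rewrite (u1E (- 1) 1) ?mulr1 ?mul1r ?mulN1r.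
- exists (vec4 x0 x1 (- x2) (- x3)); first by rewrite !inE eqxx ?orbT.
  by apply: fin => //; rewrite (u1E (- 1) (- 1)) ?mulrNN ?mulr1 ?mul1r ?mulN1r.
Qed.

(* With A_r = y_s x_t - y_t x_s and S_r = y_s x_t + y_t x_s, the matrix
   (y_i x_j) has entries y0 xr = (S_r + ar A_r) / 2, ys xt = (S_r + A_r) / 2, and
   so on; the two conclusions are the vanishing of its 2 x 2 minors on rows
   0, s and columns r, t, and on rows r, t and columns 0, s. *)
Lemma minor_relations (ar at' x0 xr xs xt y0 yr ys yt : k) : (2 : k) != 0 ->
  let Ar := ys * xt - yt * xs in let Sr := ys * xt + yt * xs in
  let At := yr * xs - ys * xr in let St := yr * xs + ys * xr in
  y0 * xr - yr * x0 = ar * Ar -> y0 * xr + yr * x0 = Sr ->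
  y0 * xt - yt * x0 = at' * At -> y0 * xt + yt * x0 = St ->
  (1 + ar) * (Ar * Sr) = - (1 - at') * (At * St) /\
  Sr ^+ 2 + ar * Ar ^+ 2 = St ^+ 2 - at' * At ^+ 2.
Proof.
move=> two Ar Sr At St mr pr mt pt.
have f1 : (Sr + ar * Ar) * (Sr + Ar) = (St + at' * At) * (St - At).
  by rewrite -mr -mt -{1}pr -{1}pt /Sr /Ar /St /At; ring.
have f2 : (Sr - ar * Ar) * (Sr - Ar) = (St - at' * At) * (St + At).
  by rewrite -mr -mt -{1}pr -{1}pt /Sr /Ar /St /At; ring.
(* From here A and S count as independent unknowns: the difference of [f1] and [f2] is twice the
   first claim, their sum twice the second. *)
clearbody Ar Sr At St.
split; apply: (mulfI two).
- transitivity ((Sr + ar * Ar) * (Sr + Ar) - (Sr - ar * Ar) * (Sr - Ar)).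
    by ring.
  by rewrite f1 f2; ring.
- transitivity ((Sr + ar * Ar) * (Sr + Ar) + (Sr - ar * Ar) * (Sr - Ar)).
    by ring.
  by rewrite f1 f2; ring.
Qed.

End Coordinates.

(** * Pairs of consecutive actions, and the 20 points *)

Section PointScheme.

Variables (k : fieldType) (a b c i al be ga : k).
Hypothesis H : standing a b c i al be ga.
Implicit Types u v p : 'rV[k]_4.

Local Notation PP := (PP a b c i).
Local Notation theta := (theta a b c i).

(** Entry r comes from substituting [v = twist r u] in the relations; the default is never
    reached. *)
Definition tkappa (r : 'I_4) : k * k * k :=
  nth (1, 1, 1)
    [:: (1, 1, 1); (-1, - be, ga); (al, -1, - ga); (- al, be, -1)] r.

(* [gam 0] negates the coordinates 1, 2 and 3. *)
Definition twist (r : 'I_4) u := if r == 0 then u else gam r u.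

Lemma two_neq0 : (2 : k) != 0.
Proof.
apply/eqP => two0; have := char_neq2 H; rewrite inE /=.
by rewrite two0 eqxx.
Qed.

Lemma notin_signs x : x \notin [:: 0; 1; -1 : k] ->
  [/\ x != 0, 1 + x != 0 & 1 - x != 0].
Proof.
rewrite !inE !negb_or => /and3P[x0 x1 xN1]; split=> //.
  by rewrite addrC addr_eq0.
by rewrite subr_eq0 eq_sym.
Qed.

Lemma prod_signs : (1 + al) * (1 + be) * (1 + ga) = (1 - al) * (1 - be) * (1 - ga).
Proof.
apply/eqP; rewrite -subr_eq0; apply/eqP.
transitivity (2 * (al + be + ga + al * be * ga)); first by ring.
by rewrite (sum_eq0 H) mulr0.
Qed.

(** Three sign changes around the cycle give prod (1 + al_r) w1 = - prod (1 - al_r) w1. The two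
    products agree and are nonzero, so [w1 = 0] as 2 is invertible. *)
Lemma cyclic_eq0 w1 w2 w3 :
  (1 + al) * w1 = - (1 - ga) * w3 -> (1 + be) * w2 = - (1 - al) * w1 ->
  (1 + ga) * w3 = - (1 - be) * w2 -> [/\ w1 = 0, w2 = 0 & w3 = 0].
Proof.
have [_ al1 _] := notin_signs (al_notin H).
have [_ be1 _] := notin_signs (be_notin H).
have [_ ga1 _] := notin_signs (ga_notin H).
move=> e1 e2 e3.
have w1_0 : w1 = 0.
  apply: (mulfI (mulf_neq0 two_neq0 (mulf_neq0 (mulf_neq0 al1 be1) ga1))).
  rewrite mulr0; transitivity ((1 + al) * (1 + be) * (1 + ga) * w1
      + (1 - al) * (1 - be) * (1 - ga) * w1); first by rewrite -prod_signs; ring.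
  transitivity ((1 + be) * (1 + ga) * ((1 + al) * w1)
      + (1 - al) * (1 - be) * (1 - ga) * w1); first by ring.
  rewrite e1; transitivity (- (1 - ga) * (1 + be) * ((1 + ga) * w3)
      + (1 - al) * (1 - be) * (1 - ga) * w1); first by ring.
  rewrite e3; transitivity ((1 - ga) * (1 - be) * ((1 + be) * w2)
      + (1 - al) * (1 - be) * (1 - ga) * w1); first by ring.
  by rewrite e2; ring.
have w2_0 : w2 = 0 by apply: (mulfI be1); rewrite e2 w1_0 !mulr0.
by split=> //; apply: (mulfI ga1); rewrite e3 w2_0 !mulr0.
Qed.

(** Picking a zero factor in each A_r S_r leaves eight choices. Four are the stated alternatives; in
    the others the square equations chain up to x = - x for some x = al_r A_r^2, and every A_r
    vanishes. *)
Lemma sqr_system_cases A1 A2 A3 S1 S2 S3 :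
  A1 * S1 = 0 -> A2 * S2 = 0 -> A3 * S3 = 0 ->
  S1 ^+ 2 + al * A1 ^+ 2 = S3 ^+ 2 - ga * A3 ^+ 2 ->
  S2 ^+ 2 + be * A2 ^+ 2 = S1 ^+ 2 - al * A1 ^+ 2 ->
  S3 ^+ 2 + ga * A3 ^+ 2 = S2 ^+ 2 - be * A2 ^+ 2 ->
  [\/ [/\ A1 = 0, A2 = 0 & A3 = 0], [/\ A1 = 0, S2 = 0 & S3 = 0],
      [/\ S1 = 0, A2 = 0 & S3 = 0] | [/\ S1 = 0, S2 = 0 & A3 = 0]].
Proof.
have [al0 _ _] := notin_signs (al_notin H).
have [be0 _ _] := notin_signs (be_notin H).
have [ga0 _ _] := notin_signs (ga_notin H).
have orE (x y : k) : x * y = 0 -> x = 0 \/ y = 0.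
  by move/eqP; rewrite mulf_eq0 => /orP[] /eqP; [left|right].
have sq0 (x : k) : x ^+ 2 = 0 -> x = 0.
  by move/eqP; rewrite sqrf_eq0 => /eqP.
have csq0 (q x : k) : q != 0 -> q * x ^+ 2 = 0 -> x = 0.
  by move=> qn0 /orE[q0|/sq0 //]; rewrite q0 eqxx in qn0.
have dbl (x : k) : x = - x -> x = 0.
  move=> e; apply: (mulfI two_neq0); rewrite mulr0.
  by transitivity (x + x); [ring | rewrite {1}e addNr].
move=> /orE w1 /orE w2 /orE w3 e1 e2 e3.
have z2 : (0 : k) ^+ 2 = 0 by rewrite expr0n.
case: w1 => d1; case: w2 => d2; case: w3 => d3; move: e1 e2 e3;
  rewrite d1 d2 d3 z2 ?(mulr0, addr0, subr0, add0r, sub0r) => e1 e2 e3;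
  try by [constructor 1|constructor 2|constructor 3|constructor 4].
(* Left over are the choices with a single S_r = 0, in the order r = 3, 2, 1, and then S_1 = S_2 =
   S_3 = 0. *)
- constructor 1; split=> //; apply: (csq0 ga) => //.
  by apply: dbl; rewrite {1}e3 e2 e1.
- constructor 1; split=> //; apply: (csq0 be) => //.
  by apply: dbl; rewrite {1}e2 e1 e3.
- constructor 1; split=> //; apply: (csq0 al) => //.
  by apply: dbl; rewrite {1}e1 e3 e2.
- have h : al * A1 ^+ 2 = 0 by apply: dbl; rewrite {1}e1 e3 opprK e2.
  have h3 : ga * A3 ^+ 2 = 0 by rewrite -[RHS]oppr0 -h e1 opprK.
  have h2 : be * A2 ^+ 2 = 0 by rewrite e2 h oppr0.
  by constructor 1; split; [apply: (csq0 al)|apply: (csq0 be)|apply: (csq0 ga)].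
Qed.

(** The vanishing pattern of the A_r and S_r decides r. The three vanishing terms and the three
    relations whose right-hand side they kill say that all 2 x 2 minors of [v] against [twist r u]
    vanish; the other three relations become the law. *)
Lemma rel_pair_twist u v : u != 0 -> v != 0 -> rel_pair al be ga u v ->
  exists2 r, tlaw (tkappa r) u & exists2 d, d != 0 & v = d *: twist r u.
Proof.
move=> un0 vn0 h.
have [m1 p1] := h al 1 2 3 (mem_head _ _).
have mem2 : (be, (2, 3, 1)) \in cyclic_data al be ga by rewrite !inE eqxx orbT.
have mem3 : (ga, (3, 1, 2)) \in cyclic_data al be ga by rewrite !inE eqxx !orbT.
have [m2 p2] := h be 2 3 1 mem2; have [m3 p3] := h ga 3 1 2 mem3.
have [w1 e1] := minor_relations two_neq0 m1 p1 m3 p3.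
have [w2 e2] := minor_relations two_neq0 m2 p2 m1 p1.
have [w3 e3] := minor_relations two_neq0 m3 p3 m2 p2.
have [z1 z2 z3] := cyclic_eq0 w1 w2 w3.
have s0 (x y : k) : x - y = 0 -> x = y by move/eqP; rewrite subr_eq0 => /eqP.
have a0 (x y : k) : x + y = 0 -> x = - y by move/eqP; rewrite addr_eq0 => /eqP.
have tw0 (r : 'I_4) : gam r u != 0.
  have /rV0Pn[j uj] := un0; apply/rV0Pn; exists j; rewrite mxE.
  by case: ifP; rewrite ?oppr_eq0.
case: (sqr_system_cases z1 z2 z3 e1 e2 e3) => [] [d1 d2 d3];
  rewrite ?(d1, d2, d3, mulr0) in m1 m2 m3 p1 p2 p3.
- have [d dn0 vE] : exists2 d, d != 0 & v = d *: u.
    apply: proportional4; rewrite //.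
    + exact: s0 m1.
    + exact: s0 m2.
    + exact: s0 m3.
    + exact: s0 d3.
    + exact/esym/(s0 _ _ d2).
    + exact: s0 d1.
  exists 0; last by exists d.
  (* Multiplied by 2d, each law is a relation with [v = d *: u] inserted; the three other cases
     argue likewise with [gam r u]. *)
  have tdn0 := mulf_neq0 two_neq0 dn0; rewrite vE !mxE in p1 p2 p3.
  split; apply: (mulfI tdn0); rewrite /= mul1r.
  + by apply: etrans (etrans _ p1) _; ring.
  + by apply: etrans (etrans _ p2) _; ring.
  + by apply: etrans (etrans _ p3) _; ring.
- have gE : gam 1 u = vec4 (u 0 0) (u 0 1) (- u 0 2) (- u 0 3).
    by rewrite {1}(vec4_eta u) gam1_vec4.
  have [d dn0 vE] : exists2 d, d != 0 & v = d *: gam 1 u.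
    apply: proportional4; rewrite // gE !vec4E ?(mulrN, mulNr, opprK).
    + by rewrite (s0 _ _ m1).
    + by rewrite (a0 _ _ p2) ?opprK.
    + by rewrite (a0 _ _ p3) ?opprK.
    + by rewrite (a0 _ _ d3) ?opprK.
    + by rewrite (a0 _ _ d2) ?opprK.
    + by rewrite (s0 _ _ d1).
  exists 1; last by exists d.
  have tdn0 := mulf_neq0 two_neq0 dn0; rewrite vE gE !mxE /= in m1 m2 m3 p1 p2 p3.
  split; apply: (mulfI tdn0); rewrite /= ?mulN1r.
  + by apply: etrans (etrans _ p1) _; ring.
  + by apply: etrans (etrans _ m2) _; ring.
  + by apply: etrans (etrans _ m3) _; ring.
- have gE : gam 2 u = vec4 (u 0 0) (- u 0 1) (u 0 2) (- u 0 3).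
    by rewrite {1}(vec4_eta u) gam2_vec4.
  have [d dn0 vE] : exists2 d, d != 0 & v = d *: gam 2 u.
    apply: proportional4; rewrite // gE !vec4E ?(mulrN, mulNr, opprK).
    + by rewrite (a0 _ _ p1) ?opprK.
    + by rewrite (s0 _ _ m2).
    + by rewrite (a0 _ _ p3) ?opprK.
    + by rewrite (a0 _ _ d3) ?opprK.
    + by rewrite (s0 _ _ d2).
    + by rewrite (a0 _ _ d1) ?opprK.
  exists 2; last by exists d.
  have tdn0 := mulf_neq0 two_neq0 dn0; rewrite vE gE !mxE /= in m1 m2 m3 p1 p2 p3.
  split; apply: (mulfI tdn0); rewrite /= ?mulN1r.
  + by apply: etrans (etrans _ m1) _; ring.
  + by apply: etrans (etrans _ p2) _; ring.
  + by apply: etrans (etrans _ m3) _; ring.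
- have gE : gam 3 u = vec4 (u 0 0) (- u 0 1) (- u 0 2) (u 0 3).
    by rewrite {1}(vec4_eta u) gam3_vec4.
  have [d dn0 vE] : exists2 d, d != 0 & v = d *: gam 3 u.
    apply: proportional4; rewrite // gE !vec4E ?(mulrN, mulNr, opprK).
    + by rewrite (a0 _ _ p1) ?opprK.
    + by rewrite (a0 _ _ p2) ?opprK.
    + by rewrite (s0 _ _ m3).
    + by rewrite (s0 _ _ d3).
    + by rewrite (a0 _ _ d2) ?opprK.
    + by rewrite (a0 _ _ d1) ?opprK.
  exists 3; last by exists d.
  have tdn0 := mulf_neq0 two_neq0 dn0; rewrite vE gE !mxE /= in m1 m2 m3 p1 p2 p3.
  split; apply: (mulfI tdn0); rewrite /= ?mulN1r.
  + by apply: etrans (etrans _ m1) _; ring.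
  + by apply: etrans (etrans _ m2) _; ring.
  + by apply: etrans (etrans _ p3) _; ring.
Qed.

Lemma tkappa_neq0 r :
  [/\ (tkappa r).1.1 != 0, (tkappa r).1.2 != 0 & (tkappa r).2 != 0].
Proof.
have [al0 _ _] := notin_signs (al_notin H).
have [be0 _ _] := notin_signs (be_notin H).
have [ga0 _ _] := notin_signs (ga_notin H).
by case: (ord4P r) => ->; rewrite /= ?oppr_eq0 !oner_eq0 ?al0 ?be0 ?ga0.
Qed.

(** The values 1, -1, [al], [- al] of kappa_1 are distinct because [al] avoids 0, 1, -1 and 2 is
    nonzero. *)
Lemma tkappa_inj r r' : (tkappa r).1.1 = (tkappa r').1.1 -> r = r'.
Proof.
have e (s : 'I_4) : (tkappa s).1.1 = [:: 1; -1; al; - al]`_s.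
  by case: (ord4P s) => ->.
rewrite !e => /eqP; rewrite nth_uniq ?ltn_ord //; first by move/eqP/val_inj.
have /and3P[a0 a1 aN] : [&& al != 0, al != 1 & al != -1].
  by have := al_notin H; rewrite !inE !negb_or.
have aa : al != - al.
  by rewrite -addr_eq0 -mulr2n -mulr_natl mulf_neq0 ?two_neq0.
rewrite /= !inE !negb_or (oneN1 H) aa eqr_opp [1 == al]eq_sym a1.
by rewrite [-1 == al]eq_sym aN andbT eq_sym eqr_oppLR aN.
Qed.

(** A coordinate vector has a single nonzero entry, so a sign change acts on it as 1 or -1. *)
Lemma PPinf_twist r d p : p \in PPinf k ->
  twist r (d *: p) = d *: p \/ twist r (d *: p) = - (d *: p).
Proof.
have tw x0 x1 x2 x3 : twist r (vec4 x0 x1 x2 x3) = vec4 x0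
    (if r \in [:: 0; 1] then x1 else - x1) (if r \in [:: 0; 2] then x2 else - x2)
    (if r \in [:: 0; 3] then x3 else - x3).
  by case: (ord4P r) => ->; rewrite /twist /= ?gam1_vec4 ?gam2_vec4 ?gam3_vec4.
have Z x0 x1 x2 x3 : d *: vec4 x0 x1 x2 x3 = vec4 (d * x0) (d * x1) (d * x2) (d * x3).
  by apply: rowP4; rewrite mxE !vec4E.
have N x0 x1 x2 x3 : - vec4 x0 x1 x2 x3 = vec4 (- x0) (- x1) (- x2) (- x3).
  by apply: rowP4; rewrite mxE !vec4E.
rewrite !inE => /or4P[] /eqP ->;
  rewrite Z tw N !mulr0 !oppr0 !if_same.
- by left.
- by case: ifP; [left|right].
- by case: ifP; [left|right].
- by case: ifP; [left|right].
Qed.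

Lemma rel_pair_uniq u v w : u != 0 -> v != 0 -> w != 0 ->
  rel_pair al be ga u v -> rel_pair al be ga u w ->
  exists2 d, d != 0 & w = d *: v.
Proof.
move=> un0 vn0 wn0 /(rel_pair_twist un0 vn0)[r lr [d dn0 vE]].
move=> /(rel_pair_twist un0 wn0)[r' lr' [d' dn0' wE]].
have [k1 k2 k3] := tkappa_neq0 r.
case: (tlaw_cases un0 k1 k2 k3 lr) => [[p hp [e _ uE]]|hu].
  have tw s : twist s u = u \/ twist s u = - u by rewrite uE; exact: PPinf_twist.
  have dd0 : d' / d != 0 by rewrite mulf_neq0 ?invr_eq0.
  by rewrite wE vE; case: (tw r) => ->; case: (tw r') => ->;
    [exists (d' / d)|exists (- (d' / d))|exists (- (d' / d))|exists (d' / d)];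
    rewrite ?oppr_eq0 // ?scalerN ?scaleNr ?opprK scalerA mulfVK.
(* Cancelling [u 0 2 * u 0 3] in the first laws for r and r' compares their kappa_1. *)
have rr' : r = r'.
  apply: tkappa_inj; apply: (mulIf (mulf_neq0 (hu 2) (hu 3))).
  by case: lr lr' => [<- _ _] [<- _ _].
exists (d' / d); first by rewrite mulf_neq0 ?invr_eq0.
by rewrite wE vE -rr' scalerA mulfVK.
Qed.

(** Each of [PP0] to [PP3] is the sign orbit of its first vector, which meets the conditions of
    [tlaw_sign_orbit] for the matching r. *)
Lemma tlaw_PP r u : u != 0 -> tlaw (tkappa r) u ->
  exists2 p, p \in PP & exists2 d, d != 0 & u = d *: p.
Proof.
move=> un0 lu; have [k1 k2 k3] := tkappa_neq0 r.
have sub (s : seq 'rV[k]_4) : {subset s <= PP} ->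
    (exists2 p, p \in s & exists2 d, d != 0 & u = d *: p) ->
    exists2 p, p \in PP & exists2 d, d != 0 & u = d *: p.
  by move=> hs [p /hs hp hd]; exists p.
case: (tlaw_cases un0 k1 k2 k3 lu) => [|hu {k1 k2 k3}].
  by apply: sub => p hp; rewrite /Defs.PP mem_cat hp.
have sq0 (x y : k) : x ^+ 2 = y -> y \notin [:: 0; 1; -1 : k] -> x != 0.
  by move=> <- /notin_signs[]; rewrite sqrf_eq0.
have hi := i_sqr H; have ha := a_sqr H; have hb := b_sqr H; have hc := c_sqr H.
have an0 := sq0 _ _ ha (al_notin H); have bn0 := sq0 _ _ hb (be_notin H).
have cn0 := sq0 _ _ hc (ga_notin H).
move: lu; case: (ord4P r) => -> lu.
- apply: (sub (sign_orbit 1 1 1 1)).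
    by move=> p hp; rewrite /Defs.PP !mem_cat hp ?orbT.
  by apply: tlaw_sign_orbit lu; rewrite //= ?oner_neq0 //; ring.
- apply: (sub (sign_orbit (b * c) (- i) (- (i * b)) (- c))).
    by move=> p; rewrite /sign_orbit !opprK => hp; rewrite /Defs.PP !mem_cat hp ?orbT.
  by apply: tlaw_sign_orbit lu; rewrite //= ?mulf_neq0 // -?ha -?hb -?hc; ring: hi.
- apply: (sub (sign_orbit (a * c) (- a) (- i) (- (i * c)))).
    by move=> p; rewrite /sign_orbit !opprK => hp; rewrite /Defs.PP !mem_cat hp ?orbT.
  by apply: tlaw_sign_orbit lu; rewrite //= ?mulf_neq0 // -?ha -?hb -?hc; ring: hi.
- apply: (sub (sign_orbit (a * b) (- (i * a)) (- b) (- i))).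
    by move=> p; rewrite /sign_orbit !opprK => hp; rewrite /Defs.PP !mem_cat hp ?orbT.
  by apply: tlaw_sign_orbit lu; rewrite //= ?mulf_neq0 // -?ha -?hb -?hc; ring: hi.
Qed.

Lemma rel_pairZl d u v : rel_pair al be ga u v -> rel_pair al be ga (d *: u) v.
Proof.
move=> h e r s t /h[h1 h2]; rewrite !mxE; split.
- transitivity (d * (v 0 0 * u 0 r - v 0 r * u 0 0)); first by ring.
  by rewrite h1; ring.
- transitivity (d * (v 0 0 * u 0 r + v 0 r * u 0 0)); first by ring.
  by rewrite h2; ring.
Qed.

(** By induction: up to scaling [lam n], both [lam n.+1] and [iter n.+1 theta u] follow the same
    vector [iter n theta u], so [rel_pair_uniq] makes them proportional. *)
Lemma rel_pair_orbit (lam : nat -> 'rV[k]_4) :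
  (forall n, lam n != 0) -> (forall n, rel_pair al be ga (lam n) (lam n.+1)) ->
  exists2 u, u \in PP &
    forall n, exists2 d, d != 0 & lam n = d *: iter n theta u.
Proof.
move=> lam0 hlam.
have [r lr _] := rel_pair_twist (lam0 0) (lam0 1) (hlam 0).
have [u hu [d dn0 e0]] := tlaw_PP (lam0 0) lr; exists u => //.
elim=> [|n [e en0 eE]]; first by exists d.
have hn := iter_theta_in H n hu.
have := hlam n.
move=> /(rel_pairZl e^-1); rewrite {1}eE scalerA mulVf // scale1r.
apply: rel_pair_uniq (rel_pair_theta H hn); rewrite ?lam0 //; apply: PP_neq0 H _ _ => //.
exact: theta_in H _ hn.
Qed.

End PointScheme.

(** * Graded modules with scalars acting through [c%:A] *)

Section GradedModules.

Variables (k : fieldType) (A : algType k) (Adeg : nat -> A -> Prop).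
Implicit Types M N : grmod Adeg.

Lemma algA_comm (V : lmodType A) (c : k) (q : A) (x : V) :
  c%:A *: (q *: x) = q *: (c%:A *: x).
Proof. by rewrite !scalerA mulr_algl mulr_algr. Qed.

Lemma algA_scaleA (V : lmodType A) (c d : k) (x : V) :
  c%:A *: (d%:A *: x) = (c * d)%:A *: x.
Proof. by rewrite scalerA mulr_algl scalerA. Qed.

Lemma algA_scaleD (V : lmodType A) (c d : k) (x : V) :
  (c + d)%:A *: x = c%:A *: x + d%:A *: x.
Proof. by rewrite !scalerDl. Qed.

Lemma algA_scaleB (V : lmodType A) (c d : k) (x : V) :
  (c - d)%:A *: x = c%:A *: x - d%:A *: x.
Proof. by rewrite !scalerBl. Qed.

Lemma algA_scale_eq0 (V : lmodType A) (c : k) (x : V) :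
  x != 0 -> c%:A *: x = 0 -> c = 0.
Proof.
move=> xn0 cx0; apply/eqP; apply: contraNT xn0 => cn0.
by rewrite -[x]scale1r -[1]scale1r -(mulVf cn0) -algA_scaleA cx0 scaler0.
Qed.

Section Relations.

Variables (V : lmodType A) (x y z w : A) (v v2 : V) (xy yx zw wz : k).
Hypotheses (v2_neq0 : v2 != 0)
  (xyE : x *: (y *: v) = xy%:A *: v2) (yxE : y *: (x *: v) = yx%:A *: v2)
  (zwE : z *: (w *: v) = zw%:A *: v2) (wzE : w *: (z *: v) = wz%:A *: v2).

Lemma minus_relation_coef d :
  (x * y - y * x - d *: (z * w - w * z)) *: v = 0 -> xy - yx = d * (zw - wz).
Proof.
rewrite minus_actE xyE yxE zwE wzE -!algA_scaleB algA_scaleA -algA_scaleB.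
move/(algA_scale_eq0 v2_neq0)/eqP.
by rewrite subr_eq0 => /eqP.
Qed.

Lemma plus_relation_coef :
  (x * y + y * x - (z * w + w * z)) *: v = 0 -> xy + yx = zw + wz.
Proof.
rewrite plus_actE xyE yxE zwE wzE -!algA_scaleD -algA_scaleB.
move/(algA_scale_eq0 v2_neq0)/eqP.
by rewrite subr_eq0 => /eqP.
Qed.

End Relations.

Lemma grmod_iso_sym M N : grmod_iso M N -> grmod_iso N M.
Proof.
case=> f [g fK gK] fdeg.
have glin : linear g.
  by move=> c x y; apply: (can_inj fK); rewrite linearP !gK.
pose gl : {linear N -> M} := HB.pack g (GRing.isLinear.Build A N M _ g glin).
exists gl; first by exists f.
by move=> n x; rewrite fdeg /= gK.
Qed.

Lemma gen_deg0_iso M N : grmod_iso M N -> gen_deg0 M -> gen_deg0 N.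
Proof.
case=> f [g fK gK] fdeg gM y; have [s [hs e]] := gM (g y).
exists [seq (ax.1, f ax.2) | ax <- s]; split.
  move=> ax'; elim: s hs {e} => //= ax s IH hs [<-|]; last first.
    by apply: IH => ax1 h; apply: hs; right.
  by apply/fdeg/hs; left.
rewrite -[y]gK e big_map linear_sum; apply: eq_bigr => ax _.
by rewrite linearZ.
Qed.

End GradedModules.

(** * Relators and induction in the quotient algebra *)

Lemma aq_piB (k : fieldType) (A : algType k) (I : tsideal A) (f g : A) :
  aq_pi I (f - g) = aq_pi I f - aq_pi I g.
Proof. exact: (raddfB (\pi_{ideal_quot ts_pred I})%qT). Qed.

Lemma aq_pi_minus (k : fieldType) (A : algType k) (I : tsideal A) (d : k) (x y z w : A) :
  aq_pi I (x * y - y * x - d *: (z * w - w * z)) =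
  aq_pi I x * aq_pi I y - aq_pi I y * aq_pi I x
    - d *: (aq_pi I z * aq_pi I w - aq_pi I w * aq_pi I z).
Proof. by rewrite !(aq_piB, aq_piZ, aq_piM). Qed.

Lemma aq_pi_plus (k : fieldType) (A : algType k) (I : tsideal A) (x y z w : A) :
  aq_pi I (x * y + y * x - (z * w + w * z)) =
  aq_pi I x * aq_pi I y + aq_pi I y * aq_pi I x
    - (aq_pi I z * aq_pi I w + aq_pi I w * aq_pi I z).
Proof. by rewrite !(aq_piB, aq_piD, aq_piM). Qed.

Section Induction.

Variable k : fieldType.

(** Every element is a combination of words, and a word arises from 1 by multiplying by letters on
    the left. *)
Lemma free4_ind (P : free4 k -> Prop) : P 0 -> P 1 ->
  (forall c f, P f -> P (c *: f)) -> (forall f g, P f -> P g -> P (f + g)) ->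
  (forall j f, P f -> P (free_y k j * f)) -> forall f, P f.
Proof.
move=> P0 P1 PZ PD Py f; rewrite [f]monalgE.
apply: (big_ind P) => // w _.
have -> : << f@_w *g w >> = f@_w *: (<< w >> : free4 k).
  by apply/malgP => w'; rewrite mcoeffZ !mcoeffU mulrnAr mulr1.
apply: PZ; case: w => s.
elim: s => [|j s IH].
  by have -> : << FMonom [::] >> = 1 :> free4 k by congr << _ >>; exact/esym/val_inj/fm1.
have -> : << FMonom (j :: s) >> = free_y k j * << FMonom s >> :> free4 k.
  rewrite /free_y [RHS]malgM_def fgmulUU mulr1; congr << _ >>.
  by apply: val_inj; rewrite /= fmM fmuE.
exact: Py.
Qed.

Variables al be ga : k.
Local Notation tQ := (tQ al be ga).

(** Reduces linearity and stability under [tQ] to scalars and the four generators. *)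
Lemma tQ_ind (P : tQ -> Prop) : P 0 -> P 1 ->
  (forall c q, P q -> P (c *: q)) -> (forall q r, P q -> P r -> P (q + r)) ->
  (forall j q, P q -> P (tQ_y al be ga j * q)) -> forall q, P q.
Proof.
move=> P0 P1 PZ PD Py q; rewrite -[q]aq_reprK.
elim/free4_ind: (aq_repr q) => [||c f|f g|j f].
- by rewrite aq_pi0.
- by rewrite aq_pi1.
- by rewrite aq_piZ; exact: PZ.
- by rewrite aq_piD; exact: PD.
- by rewrite aq_piM; exact: Py.
Qed.

Lemma tQ_y_deg j : tQ_deg 1 (tQ_y al be ga j).
Proof.
exists (free_y k j) => // w; rewrite /free_y msuppU oner_eq0 inE => /eqP ->.
by rewrite /fdeg fmuE.
Qed.

Lemma minus_relator_pi (d : k) r s t :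
  aq_pi (tQ_ideal al be ga) (minus_relator (d, (r, s, t))) =
  tQ_y al be ga 0 * tQ_y al be ga r - tQ_y al be ga r * tQ_y al be ga 0
    - d *: (tQ_y al be ga s * tQ_y al be ga t - tQ_y al be ga t * tQ_y al be ga s).
Proof. exact: aq_pi_minus. Qed.

Lemma plus_relator_pi (d : k) r s t :
  aq_pi (tQ_ideal al be ga) (plus_relator (d, (r, s, t))) =
  tQ_y al be ga 0 * tQ_y al be ga r + tQ_y al be ga r * tQ_y al be ga 0
    - (tQ_y al be ga s * tQ_y al be ga t + tQ_y al be ga t * tQ_y al be ga s).
Proof. exact: aq_pi_plus. Qed.

Lemma tQ_relator (f : free4 k) (V : lmodType tQ) (x : V) :
  f \in relators al be ga -> aq_pi (tQ_ideal al be ga) f *: x = 0.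
Proof.
move=> hf; rewrite (_ : aq_pi _ f = 0) ?scale0r // -aq_pi0; apply/aq_piP.
by rewrite subr0; apply/tQ_relP; exact: ideal_gen_in.
Qed.

End Induction.

(** * A graded module with a homogeneous basis is the sequence module of its structure constants *)

Section BasisIso.

Variables (k : fieldType) (al be ga : k).
Local Notation tQ := (tQ al be ga).
Local Notation y := (tQ_y al be ga).
Variables (M : grmod (@tQ_deg k al be ga)) (e : nat -> M).
Hypothesis e_deg : forall n, gm_deg n (e n).
Hypothesis e_neq0 : forall n, e n != 0.
Hypothesis e_span : forall n x, gm_deg n x -> exists c : k, x = c%:A *: e n.

Lemma basis_action : exists lam : nat -> 'rV[k]_4,
  forall n j, y j *: e n = (lam n 0 j)%:A *: e n.+1.
Proof.
have h n : exists l : 'rV[k]_4, forall j, y j *: e n = (l 0 j)%:A *: e n.+1.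
  have hj j : exists c : k, y j *: e n = c%:A *: e n.+1.
    apply: e_span; rewrite -(add1n n).
    exact: (graded_act (gm_graded M)) (tQ_y_deg _ _ _ j) (e_deg n).
  have [l hl] := boolp.choice hj; exists (\row_j l j) => j; by rewrite mxE.
by have [lam hlam] := boolp.choice h; exists lam.
Qed.

Variable lam : nat -> 'rV[k]_4.
Hypothesis e_act : forall n j, y j *: e n = (lam n 0 j)%:A *: e n.+1.

(** A relator kills [e n] and acts on it as a scalar times the nonzero [e n.+2], so the scalar is 0.
    The left letter acts second and contributes an entry of [lam n.+1]. *)
Lemma basis_rel_pair n : rel_pair al be ga (lam n) (lam n.+1).
Proof.
have act2 j l : y j *: (y l *: e n) = (lam n.+1 0 j * lam n 0 l)%:A *: e n.+2.
  rewrite e_act -[LHS](@algA_comm k tQ) e_act.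
  by rewrite [LHS](@algA_scaleA k tQ) mulrC.
move=> c r s t hd; split.
- have mem : minus_relator (c, (r, s, t)) \in relators al be ga.
    by rewrite mem_cat; apply/orP; left; exact: map_f hd.
  have := tQ_relator (e n) mem; rewrite minus_relator_pi.
  exact: minus_relation_coef (e_neq0 _) (act2 _ _) (act2 _ _) (act2 _ _) (act2 _ _) _.
- have mem : plus_relator (c, (r, s, t)) \in relators al be ga.
    by rewrite mem_cat; apply/orP; right; exact: map_f hd.
  have := tQ_relator (e n) mem; rewrite plus_relator_pi.
  exact: plus_relation_coef (e_neq0 _) (act2 _ _) (act2 _ _) (act2 _ _) (act2 _ _).
Qed.

Hypothesis lam_rel : forall n, rel_pair al be ga (lam n) (lam n.+1).

Definition basis_map (p : seqmod lam_rel) : M :=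
  \sum_(n < size (seqmod_poly p)) ((seqmod_poly p)`_n)%:A *: e n.

(** Allows polynomials of different sizes to be summed over one range. *)
Lemma basis_mapE N (p : seqmod lam_rel) : (size (seqmod_poly p) <= N)%N ->
  basis_map p = \sum_(n < N) ((seqmod_poly p)`_n)%:A *: e n.
Proof.
move=> le; rewrite /basis_map (big_ord_widen _ (fun n => ((seqmod_poly p)`_n)%:A *: e n) le).
rewrite big_mkcond; apply: eq_bigr => n _; case: ltnP => // ge.
by rewrite nth_default // scale0r scale0r.
Qed.

Lemma basis_mapD p q : basis_map (p + q) = basis_map p + basis_map q.
Proof.
pose N := maxn (size (seqmod_poly p)) (size (seqmod_poly q)).
rewrite (@basis_mapE N p) ?leq_maxl // (@basis_mapE N q) ?leq_maxr //.
rewrite (@basis_mapE N) ?seqmod_polyD ?size_polyD // -big_split /=.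
apply: eq_bigr => n _; rewrite coefD.
exact: algA_scaleD.
Qed.

Lemma basis_mapZ (c : k) p : basis_map (c%:A *: p) = c%:A *: basis_map p.
Proof.
rewrite (@basis_mapE (size (seqmod_poly p))) ?seqmodZ ?size_scale_leq //.
rewrite /basis_map [RHS](@scaler_sumr tQ M); apply: eq_bigr => n _.
by rewrite coefZ [RHS](@algA_scaleA k tQ).
Qed.

Lemma basis_map_y j p : basis_map (y j *: p) = y j *: basis_map p.
Proof.
have pE : y j *: p = poly_seqmod lam_rel (shift_act lam j (seqmod_poly p)).
  exact: seqmod_y.
rewrite (@basis_mapE (size (seqmod_poly p)).+1); last first.
  rewrite pE; apply/leq_sizeP => -[//|n] hn.
  by rewrite shift_actS nth_default // mulr0.
(* The shifted polynomial has no constant term, so its sum starts at index 1 and matches the other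
   sum term by term. *)
rewrite big_ord_recl pE shift_act_coef0 scale0r scale0r add0r /basis_map [RHS](@scaler_sumr tQ M).
apply: eq_bigr => n _; rewrite -[RHS](@algA_comm k tQ) e_act.
rewrite [RHS](@algA_scaleA k tQ) mulrC.
exact: (congr1 (fun c => c%:A *: e n.+1) (shift_actS _ _ _ _)).
Qed.

Lemma basis_map_linear : linear basis_map.
Proof.
move=> q x z; rewrite basis_mapD; congr (_ + _).
elim/tQ_ind: q x => [||c q hq|q r hq hr|j q hq] x.
- by rewrite !scale0r /basis_map size_poly0 big_ord0.
- by rewrite !scale1r.
- by rewrite -mulr_algl -!scalerA basis_mapZ hq.
- by rewrite !scalerDl basis_mapD hq hr.
- by rewrite -!scalerA basis_map_y hq.
Qed.

(** The [e n] are nonzero and of distinct degrees, hence independent. *)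
Lemma basis_map_inj : injective basis_map.
Proof.
move=> p q pq; apply: (@seqmod_polyI k).
pose N := maxn (size (seqmod_poly p)) (size (seqmod_poly q)).
pose z n := ((seqmod_poly p)`_n - (seqmod_poly q)`_n)%:A *: e n.
have zdeg n : gm_deg n (z n).
  (* Adding 0 brings the term to the form c x + y of [gradedP]. *)
  rewrite -[z n]addr0; apply: (gradedP (gm_graded M)) => //.
  exact: (graded0 (gm_graded M)).
have zsum : \sum_(n < N) z n = 0.
  have pN : (size (seqmod_poly p) <= N)%N := leq_maxl _ _.
  have qN : (size (seqmod_poly q) <= N)%N := leq_maxr _ _.
  apply: etrans (_ : basis_map p - basis_map q = 0); last by rewrite pq subrr.
  rewrite (basis_mapE pN) (basis_mapE qN) -sumrB.
  by apply: eq_bigr => n _; exact: algA_scaleB.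
apply/polyP => n; have [ltnN|geN] := ltnP n N; last first.
  by move: geN; rewrite geq_max => /andP[? ?]; rewrite !nth_default.
have := graded_free (gm_graded M) zdeg zsum ltnN.
by move/(algA_scale_eq0 (e_neq0 n))/eqP; rewrite subr_eq0 => /eqP.
Qed.

Lemma basis_map_monom n (c : k) :
  basis_map (poly_seqmod lam_rel (c *: 'X^n)) = c%:A *: e n.
Proof.
rewrite (@basis_mapE n.+1); last first.
  by rewrite (leq_trans (size_scale_leq _ _)) // size_polyXn.
rewrite big_ord_recr big1 /= => [|m _].
  by rewrite coefZ coefXn eqxx mulr1 add0r.
by rewrite coefZ coefXn ltn_eqF // mulr0 scale0r scale0r.
Qed.

Lemma basis_map_surj x : exists p, basis_map p = x.
Proof.
have [N [z [hz ->]]] := graded_span (gm_graded M) x.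
elim/big_ind: _ => [|_ _ [p <-] [q <-]|n _].
- by exists 0; rewrite /basis_map size_poly0 big_ord0.
- by exists (p + q); rewrite basis_mapD.
- have [c ->] := e_span (hz n).
  by exists (poly_seqmod lam_rel (c *: 'X^n)); rewrite basis_map_monom.
Qed.

Lemma basis_iso : grmod_iso M (seq_grmod lam_rel).
Proof.
apply: grmod_iso_sym.
pose f : {linear seq_grmod lam_rel -> M} := HB.pack basis_map
  (GRing.isLinear.Build tQ (seq_grmod lam_rel) M _ basis_map basis_map_linear).
have [g gK] := boolp.choice basis_map_surj.
exists f; first by exists g => // p; apply: basis_map_inj; rewrite gK.
move=> n p; split=> [hp|].
  have -> : f p = ((seqmod_poly p)`_n)%:A *: e n + 0.
    by rewrite addr0 -basis_map_monom /=; congr basis_map; exact: hp.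
  by apply: (gradedP (gm_graded M)) => //; exact: (graded0 (gm_graded M)).
(* An image of degree n is a multiple of [e n], hence the image of a multiple of ['X^n]; injectivity
   identifies [p] with that monomial. *)
move=> /e_span[c]; rewrite -basis_map_monom => /basis_map_inj ->.
exact: seqmod_degZX.
Qed.

End BasisIso.

(** If [lam n = 0], the polynomials of size at most n + 1 form a submodule containing degree 0, so
    ['X^(n.+1)] is not generated from degree 0. *)
Lemma seq_gen_neq0 (k : fieldType) (al be ga : k) (lam : nat -> 'rV[k]_4)
    (lam_rel : forall n, rel_pair al be ga (lam n) (lam n.+1)) :
  gen_deg0 (seq_grmod lam_rel) -> forall n, lam n != 0.
Proof.
move=> gen n; apply/eqP => lam0.
have stable (q : tQ al be ga) (x : seqmod lam_rel) :
    (size (seqmod_poly x) <= n.+1)%N -> (size (seqmod_poly (q *: x)) <= n.+1)%N.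
  elim/tQ_ind: q x => [||c q hq|q r hq hr|j q hq] x hx.
  - by rewrite scale0r size_poly0.
  - by rewrite scale1r.
  - rewrite -mulr_algl -scalerA seqmodZ.
    by rewrite (leq_trans (size_scale_leq _ _)) // hq.
  - rewrite scalerDl seqmod_polyD (leq_trans (size_polyD _ _)) //.
    by rewrite geq_max hq ?hr.
  - rewrite -scalerA; move: (hq x hx); move: (q *: x) => z {hq hx} hz.
    rewrite [y in seqmod_poly y](seqmod_y lam_rel j (seqmod_poly z)).
    apply/leq_sizeP => -[//|m]; rewrite ltnS => le; rewrite shift_actS.
    (* Coefficient m + 1 with m >= n vanishes: for m = n through [lam n = 0], beyond that through
       the size of [z]. *)
    have [->|ne] := eqVneq m n; first by rewrite lam0 mxE mul0r.
    by rewrite nth_default ?mulr0 // (leq_trans hz) // ltn_neqAle eq_sym ne.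
have [s [hs e]] := gen (poly_seqmod lam_rel 'X^(n.+1)).
suff : (size (seqmod_poly (poly_seqmod lam_rel 'X^(n.+1))) <= n.+1)%N.
  by rewrite /seqmod_poly /poly_seqmod size_polyXn ltnn.
rewrite e; elim: s hs {e} => [|ax s IH] hs; first by rewrite big_nil size_poly0.
rewrite big_cons (leq_trans (size_polyD _ _)) // geq_max IH ?andbT; last first.
  by move=> ax' h; apply: hs; right.
apply: stable; have -> := hs ax (or_introl erefl).
by rewrite (leq_trans (size_scale_leq _ _)) // expr0 size_poly1.
Qed.

Theorem theorem9p3 (k : closedFieldType) (al be ga a b c i : k)
    (H : standing a b c i al be ga)
    (M : grmod (@tQ_deg k al be ga)) :
  point_module M ->
  exists (u : 'rV[k]_4) (hu : u \in PP a b c i), grmod_iso M (ptmod H hu).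
Proof.
case=> gen dim.
have basis n : exists x : M, [/\ gm_deg n x, x != 0 &
    forall y, gm_deg n y -> exists d : k, y = d%:A *: x].
  by have [x [xdeg xn0] xspan] := dim n; exists x.
have [e he] := boolp.choice basis.
have e_deg n : gm_deg n (e n) by case: (he n).
have e_neq0 n : e n != 0 by case: (he n).
have e_span n x : gm_deg n x -> exists d : k, x = d%:A *: e n.
  by case: (he n) => _ _; apply.
have [lam e_act] := basis_action e_deg e_span.
have lam_rel := basis_rel_pair e_neq0 e_act.
(* This first isomorphism carries generation in degree 0 over to the sequence module, which forces
   every [lam n] to be nonzero. *)
have isoM := basis_iso e_deg e_neq0 e_span e_act lam_rel.
have lam_neq0 := seq_gen_neq0 (gen_deg0_iso isoM gen).
have [u hu hlam] := rel_pair_orbit H lam_neq0 lam_rel.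
have ratio n : exists d : k, d != 0 /\ lam n = d *: iter n (theta a b c i) u.
  by have [d dn0 dE] := hlam n; exists d.
have [d hd] := boolp.choice ratio.
(* Since [lam n] is [d n] times the n-th iterate of u, rescaling [e n] by the product of the earlier
   [d m] absorbs these factors: the new structure constants are exactly those of M_u, and
   [basis_iso] applies again. *)
pose s n := \prod_(m < n) d m.
have s_neq0 n : s n != 0 by apply/prodf_neq0 => m _; case: (hd m).
exists u, hu.
apply: (@basis_iso k al be ga M (fun n => (s n)%:A *: e n)) => [n|n|n x|n j].
- rewrite -[_ *: _]addr0; apply: (gradedP (gm_graded M)) => //.
  exact: (graded0 (gm_graded M)).
- by apply: contra_neq (s_neq0 n); exact: algA_scale_eq0.
- move=> /e_span[f ->]; exists (f / s n).
  by rewrite [RHS](@algA_scaleA k _ M) mulfVK.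
- have sE : s n * lam n 0 j = iter n (theta a b c i) u 0 j * s n.+1.
    by rewrite /s big_ord_recr /= (hd n).2 mxE; ring.
  rewrite -[LHS](@algA_comm k _ M) e_act [LHS](@algA_scaleA k _ M) sE.
  exact/esym/algA_scaleA.
Qed.
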